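(* (In $\mathbf{ZF}$.) Let $\mathbf{X}$ be a Hausdorff first-countable space with underlying set $X$. Consider the statements: $\mathbf{UIC}(\mathbf{X})$: every uncountable subset of $X$ contains an infinite closed subset of $\mathbf{X}$; $\mathbf{UISC}(\mathbf{X})$: every uncountable subset of $X$ contains an infinite sequentially closed set of $\mathbf{X}$; $\mathbf{ISCIC}(\mathbf{X})$: every infinite sequentially closed subset of $\mathbf{X}$ contains an infinite closed subset of $\mathbf{X}$; $\mathbf{IDI}(\mathbf{X})$: every infinite subset of $X$ is Dedekind-infinite. Then: (i) $\mathbf{UIC}(\mathbf{X})\leftrightarrow(\mathbf{ISCIC}(\mathbf{X})\wedge\mathbf{UISC}(\mathbf{X}))$; (ii) $(\mathbf{IDI}(\mathbf{X})\wedge\mathbf{UISC}(\mathbf{X}))\rightarrow\mathbf{UIC}(\mathbf{X})$; (iii) if $\mathbf{X}$ is Cantor completely metrizable and second-countable, then $(\mathbf{IDI}(\mathbf{X})\wedge\mathbf{UISC}(\mathbf{X}))\leftrightarrow\mathbf{UIC}(\mathbf{X})$.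
   Context: The result is a theorem of $\mathbf{ZF}$ (Zermelo–Fraenkel set theory without the axiom of choice). A set is infinite if it is not equipotent with any $n\in\omega$; countable if it is equipotent with a subset of $\omega$, uncountable otherwise; Dedekind-infinite if it is equipotent with a proper subset of itself. A set $A\subseteq X$ is sequentially closed in $\mathbf{X}$ if every point of $X$ which is a limit of a sequence of points of $A$ converging in $\mathbf{X}$ belongs to $A$. For a metric $d$ on $X$, $\tau(d)$ is the topology induced by $d$ and $\delta_d(A)=\sup\{d(x,y):x,y\in A\}$. A metric $d$ on $X$ is Cantor complete if, for every descending family $\{F_n:n\in\omega\}$ of non-empty closed subsets of $\langle X,\tau(d)\rangle$ with $\lim_{n\to+\infty}\delta_d(F_n)=0$, we have $\bigcap_{n\in\omega}F_n\neq\emptyset$. A topological space $\langle X,\tau\rangle$ is Cantor completely metrizable if there is a Cantor complete metric $d$ on $X$ with $\tau=\tau(d)$. *)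

(* Defs.v *)
(* "Theorem of ZF" is rendered as "true in every model
   of first-order ZF": all notions below are internal to a structure (V, mem)
   for the language of set theory.  In particular functions, natural numbers,
   real numbers, sequences and metrics are elements of the model, and the
   existence of a function never refers to a function of the metatheory, so the
   choice principles of the metatheory say nothing about the model. *)

Set Implicit Arguments.
Unset Strict Implicit.
Unset Printing Implicit Defensive.

Structure set_structure := SetStructure {
  carrier :> Type;
  mem : carrier -> carrier -> Prop
}.

Notation "x ∈ y" := (mem x y) (at level 70, no associativity).
Notation "x ∉ y" := (~ mem x y) (at level 70, no associativity).

(* Variables are de Bruijn indices; equality is true equality. *)
(* Used for the two axiom schemes only. *)
Inductive formula : Type :=
| FMem (i j : nat)
| FEq (i j : nat)
| FFalse
| FImp (p q : formula)
| FAnd (p q : formula)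
| FOr (p q : formula)
| FAll (p : formula)
| FEx (p : formula).

Definition scons {T : Type} (x : T) (e : nat -> T) (n : nat) : T :=
  match n with O => x | S m => e m end.

Fixpoint sat {V : set_structure} (e : nat -> V) (p : formula) : Prop :=
  match p with
  | FMem i j => e i ∈ e j
  | FEq i j => e i = e j
  | FFalse => False
  | FImp q r => sat e q -> sat e r
  | FAnd q r => sat e q /\ sat e r
  | FOr q r => sat e q \/ sat e r
  | FAll q => forall x : V, sat (scons x e) q
  | FEx q => exists x : V, sat (scons x e) q
  end.

Definition subset {V : set_structure} (a b : V) : Prop :=
  forall x, x ∈ a -> x ∈ b.
Notation "a ⊆ b" := (subset a b) (at level 70, no associativity).

Definition is_empty {V : set_structure} (a : V) : Prop :=
  forall x, x ∉ a.

Definition nonempty {V : set_structure} (a : V) : Prop :=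
  exists x, x ∈ a.

Definition is_upair {V : set_structure} (z x y : V) : Prop :=
  forall w, w ∈ z <-> (w = x \/ w = y).

Definition is_union {V : set_structure} (u a : V) : Prop :=
  forall x, x ∈ u <-> exists y, x ∈ y /\ y ∈ a.

Definition is_inter {V : set_structure} (c a b : V) : Prop :=
  forall x, x ∈ c <-> (x ∈ a /\ x ∈ b).

Definition is_diff {V : set_structure} (c a b : V) : Prop :=
  forall x, x ∈ c <-> (x ∈ a /\ x ∉ b).

Definition is_powerset {V : set_structure} (p a : V) : Prop :=
  forall x, x ∈ p <-> x ⊆ a.

Definition is_succ {V : set_structure} (s x : V) : Prop :=
  forall w, w ∈ s <-> (w ∈ x \/ w = x).

Definition inductive {V : set_structure} (a : V) : Prop :=
  (exists z, is_empty z /\ z ∈ a) /\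
  (forall x, x ∈ a -> exists s, is_succ s x /\ s ∈ a).

(* Full first-order separation and replacement: the formula is evaluated in an
   arbitrary assignment [e] of parameters. *)
Record is_ZF_model (V : set_structure) : Prop := IsZFModel {
  zf_extensionality : forall a b : V, (forall x, x ∈ a <-> x ∈ b) -> a = b;
  zf_foundation : forall a : V, nonempty a ->
    exists x, x ∈ a /\ forall y, y ∈ x -> y ∉ a;
  zf_pairing : forall x y : V, exists z, is_upair z x y;
  zf_union : forall a : V, exists u, is_union u a;
  zf_powerset : forall a : V, exists p, is_powerset p a;
  zf_infinity : exists a : V, inductive a;
  zf_separation : forall (p : formula) (e : nat -> V) (a : V),
    exists b, forall x, x ∈ b <-> (x ∈ a /\ sat (scons x e) p);
  zf_replacement : forall (p : formula) (e : nat -> V) (a : V),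
    (forall x, x ∈ a -> exists! y, sat (scons y (scons x e)) p) ->
    exists b, forall y,
      y ∈ b <-> exists x, x ∈ a /\ sat (scons y (scons x e)) p
}.

(* Kuratowski pair *)
Definition is_pair {V : set_structure} (p x y : V) : Prop :=
  forall z, z ∈ p <-> (is_upair z x x \/ is_upair z x y).

Definition related {V : set_structure} (r x y : V) : Prop :=
  exists p, is_pair p x y /\ p ∈ r.

Definition is_product {V : set_structure} (c a b : V) : Prop :=
  forall p, p ∈ c <-> exists x y, x ∈ a /\ y ∈ b /\ is_pair p x y.

Definition is_fun {V : set_structure} (f a b : V) : Prop :=
  (forall p, p ∈ f -> exists x y, x ∈ a /\ y ∈ b /\ is_pair p x y) /\
  (forall x, x ∈ a -> exists! y, related f x y).

(* [f] : a * a -> b, resp. f(x, y) = z *)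
Definition is_fun2 {V : set_structure} (f a b : V) : Prop :=
  exists c, is_product c a a /\ is_fun f c b.

Definition related2 {V : set_structure} (f x y z : V) : Prop :=
  exists p, is_pair p x y /\ related f p z.

Definition equipotent {V : set_structure} (a b : V) : Prop :=
  exists f, is_fun f a b /\
    forall y, y ∈ b -> exists! x, x ∈ a /\ related f x y.

Definition is_omega {V : set_structure} (w : V) : Prop :=
  inductive w /\ forall v, inductive v -> w ⊆ v.

Definition nat_le {V : set_structure} (m n : V) : Prop := m ∈ n \/ m = n.

Definition infinite {V : set_structure} (a : V) : Prop :=
  ~ exists w n, is_omega w /\ n ∈ w /\ equipotent a n.

Definition countable {V : set_structure} (a : V) : Prop :=
  exists w s, is_omega w /\ s ⊆ w /\ equipotent a s.

Definition uncountable {V : set_structure} (a : V) : Prop := ~ countable a.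

Definition Dedekind_infinite {V : set_structure} (a : V) : Prop :=
  exists s, s ⊆ a /\ s <> a /\ equipotent a s.

Record is_topology {V : set_structure} (X t : V) : Prop := IsTopology {
  top_sub : forall u, u ∈ t -> u ⊆ X;
  top_empty : forall u, is_empty u -> u ∈ t;
  top_full : X ∈ t;
  top_inter : forall u v c, u ∈ t -> v ∈ t -> is_inter c u v -> c ∈ t;
  top_union : forall s u, s ⊆ t -> is_union u s -> u ∈ t
}.

Definition Hausdorff {V : set_structure} (X t : V) : Prop :=
  forall x y, x ∈ X -> y ∈ X -> x <> y ->
    exists u v, u ∈ t /\ v ∈ t /\ x ∈ u /\ y ∈ v /\
      forall z, ~ (z ∈ u /\ z ∈ v).

Definition local_base {V : set_structure} (t x b : V) : Prop :=
  (forall u, u ∈ b -> u ∈ t /\ x ∈ u) /\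
  (forall o, o ∈ t -> x ∈ o -> exists u, u ∈ b /\ u ⊆ o).

Definition first_countable {V : set_structure} (X t : V) : Prop :=
  forall x, x ∈ X -> exists b, countable b /\ local_base t x b.

Definition base {V : set_structure} (t b : V) : Prop :=
  b ⊆ t /\
  (forall o x, o ∈ t -> x ∈ o -> exists u, u ∈ b /\ x ∈ u /\ u ⊆ o).

Definition second_countable {V : set_structure} (t : V) : Prop :=
  exists b, countable b /\ base t b.

Definition closed {V : set_structure} (X t c : V) : Prop :=
  c ⊆ X /\ exists u, is_diff u X c /\ u ∈ t.

(* [s] is a sequence indexed by [w] = omega *)
Definition converges_to {V : set_structure} (t w s x : V) : Prop :=
  forall u, u ∈ t -> x ∈ u ->
    exists n, n ∈ w /\ forall m, m ∈ w -> nat_le n m ->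
      forall y, related s m y -> y ∈ u.

Definition sequentially_closed {V : set_structure} (X t a : V) : Prop :=
  a ⊆ X /\
  forall w s x, is_omega w -> is_fun s w a -> x ∈ X ->
    converges_to t w s x -> x ∈ a.

(* ZF proves that there is a complete ordered field and that it is unique up to
   isomorphism; "the reals" means any one of them. *)
Record real_data (V : set_structure) := RealData {
  rset : V;
  radd : V;
  rmul : V;
  rle : V;
  rzero : V;
  rone : V
}.

Definition rleq {V : set_structure} (R : real_data V) (x y : V) : Prop :=
  related (rle R) x y.

Definition rlt {V : set_structure} (R : real_data V) (x y : V) : Prop :=
  rleq R x y /\ x <> y.

Definition upper_bound {V : set_structure} (R : real_data V) (a s : V) : Prop :=
  s ∈ rset R /\ forall x, x ∈ a -> rleq R x s.

Definition is_sup {V : set_structure} (R : real_data V) (a s : V) : Prop :=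
  upper_bound R a s /\ forall b, upper_bound R a b -> rleq R s b.

Record is_real_field {V : set_structure} (R : real_data V) : Prop := IsRealField {
  rf_zero : rzero R ∈ rset R;
  rf_one : rone R ∈ rset R;
  rf_one_neq_zero : rone R <> rzero R;
  rf_add : is_fun2 (radd R) (rset R) (rset R);
  rf_mul : is_fun2 (rmul R) (rset R) (rset R);
  rf_addC : forall x y z,
    related2 (radd R) x y z -> related2 (radd R) y x z;
  rf_addA : forall x y z xy yz s,
    related2 (radd R) x y xy -> related2 (radd R) y z yz ->
    related2 (radd R) x yz s -> related2 (radd R) xy z s;
  rf_add0 : forall x, x ∈ rset R -> related2 (radd R) x (rzero R) x;
  rf_opp : forall x, x ∈ rset R ->
    exists y, y ∈ rset R /\ related2 (radd R) x y (rzero R);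
  rf_mulC : forall x y z,
    related2 (rmul R) x y z -> related2 (rmul R) y x z;
  rf_mulA : forall x y z xy yz s,
    related2 (rmul R) x y xy -> related2 (rmul R) y z yz ->
    related2 (rmul R) x yz s -> related2 (rmul R) xy z s;
  rf_mul1 : forall x, x ∈ rset R -> related2 (rmul R) x (rone R) x;
  rf_inv : forall x, x ∈ rset R -> x <> rzero R ->
    exists y, y ∈ rset R /\ related2 (rmul R) x y (rone R);
  rf_distr : forall x y z yz xy xz s,
    related2 (radd R) y z yz -> related2 (rmul R) x y xy ->
    related2 (rmul R) x z xz ->
    related2 (rmul R) x yz s -> related2 (radd R) xy xz s;
  rf_le_refl : forall x, x ∈ rset R -> rleq R x x;
  rf_le_antisym : forall x y, x ∈ rset R -> y ∈ rset R ->
    rleq R x y -> rleq R y x -> x = y;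
  rf_le_trans : forall x y z,
    x ∈ rset R -> y ∈ rset R -> z ∈ rset R ->
    rleq R x y -> rleq R y z -> rleq R x z;
  rf_le_total : forall x y, x ∈ rset R -> y ∈ rset R ->
    rleq R x y \/ rleq R y x;
  rf_le_add : forall x y z xz yz, x ∈ rset R -> y ∈ rset R ->
    rleq R x y ->
    related2 (radd R) x z xz -> related2 (radd R) y z yz -> rleq R xz yz;
  rf_le_mul : forall x y z, x ∈ rset R -> y ∈ rset R ->
    rleq R (rzero R) x -> rleq R (rzero R) y ->
    related2 (rmul R) x y z -> rleq R (rzero R) z;
  rf_complete : forall a, a ⊆ rset R -> nonempty a ->
    (exists b, upper_bound R a b) -> exists s, is_sup R a s
}.

Record is_metric {V : set_structure} (R : real_data V) (X d : V) : Prop := IsMetric {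
  met_fun : is_fun2 d X (rset R);
  met_ge0 : forall x y r, related2 d x y r -> rleq R (rzero R) r;
  met_eq0 : forall x y, x ∈ X -> y ∈ X ->
    (related2 d x y (rzero R) <-> x = y);
  met_sym : forall x y r, related2 d x y r -> related2 d y x r;
  met_triangle : forall x y z rxy ryz rxz s,
    related2 d x y rxy -> related2 d y z ryz -> related2 d x z rxz ->
    related2 (radd R) rxy ryz s -> rleq R rxz s
}.

Definition induced_topology {V : set_structure} (R : real_data V) (X d t : V) : Prop :=
  forall u, u ∈ t <->
    (u ⊆ X /\
     forall x, x ∈ u -> exists e, e ∈ rset R /\ rlt R (rzero R) e /\
       forall y r, y ∈ X -> related2 d x y r -> rlt R r e -> y ∈ u).

Definition distance_set {V : set_structure} (d a D : V) : Prop :=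
  forall r, r ∈ D <-> exists x y, x ∈ a /\ y ∈ a /\ related2 d x y r.

Definition is_diameter {V : set_structure} (R : real_data V) (d a s : V) : Prop :=
  exists D, distance_set d a D /\ is_sup R D s.

(* [F] is a function on [w] = omega whose values are sets.  Diameters lie in
   [0, +oo]; [is_diameter] holds of finite ones only, so finitely many terms
   may have infinite diameter. *)
Definition diameters_tend_to_zero {V : set_structure} (R : real_data V)
    (d w F : V) : Prop :=
  forall e, e ∈ rset R -> rlt R (rzero R) e ->
    exists n, n ∈ w /\ forall m, m ∈ w -> nat_le n m ->
      forall A, related F m A -> exists s, is_diameter R d A s /\ rlt R s e.

Definition Cantor_complete {V : set_structure} (R : real_data V) (X d : V) : Prop :=
  forall t w P F, induced_topology R X d t -> is_omega w ->
    is_powerset P X -> is_fun F w P ->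
    (forall n A, related F n A -> nonempty A /\ closed X t A) ->
    (forall m n A B, nat_le m n -> related F m A -> related F n B -> B ⊆ A) ->
    diameters_tend_to_zero R d w F ->
    exists x, forall n A, n ∈ w -> related F n A -> x ∈ A.

Definition Cantor_completely_metrizable {V : set_structure} (X t : V) : Prop :=
  exists R : real_data V, is_real_field R /\
    exists d, is_metric R X d /\ Cantor_complete R X d /\
      induced_topology R X d t.

Definition UIC {V : set_structure} (X t : V) : Prop :=
  forall a, a ⊆ X -> uncountable a ->
    exists c, c ⊆ a /\ infinite c /\ closed X t c.

Definition UISC {V : set_structure} (X t : V) : Prop :=
  forall a, a ⊆ X -> uncountable a ->
    exists c, c ⊆ a /\ infinite c /\ sequentially_closed X t c.

Definition ISCIC {V : set_structure} (X t : V) : Prop :=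
  forall a, infinite a -> sequentially_closed X t a ->
    exists c, c ⊆ a /\ infinite c /\ closed X t c.

Definition IDI {V : set_structure} (X : V) : Prop :=
  forall a, a ⊆ X -> infinite a -> Dedekind_infinite a.

(* Main.v *)
From Stdlib Require Import Arith Classical ClassicalEpsilon Setoid.
Require Import Defs.

Set Implicit Arguments.
Unset Strict Implicit.
Unset Printing Implicit Defensive.

(** The theorem rests on two facts.

    The first needs only first countability.  If [D] is countable and [x] lies
    in its closure, then a sequence in [D] converges to [x]: first countability
    gives an enumerated local base at [x], and the [m]-th term is the element of
    least index of [D] in the first [m] basic neighbourhoods
    ([cl_countable_sequence]).  The enumeration of [D] makes the choices.  Hence
    a sequentially closed set contains the closure of each of its countable
    subsets ([cl_countable_subset]).  So a countable sequentially closed set is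
    closed; as closed sets are sequentially closed, this gives the equivalence of
    [UIC] with [ISCIC] and [UISC] together.  Moreover a sequentially closed set
    with a countably infinite subset contains an infinite closed set, namely the
    closure of that subset; so [IDI] and [UISC] imply [UIC], since the
    Dedekind-infinite sets are those into which omega embeds
    ([Dedekind_infinite_iff]).

    The second is that, if the space is second-countable with a Cantor complete
    metric, then omega embeds into every infinite closed set [c]
    ([closed_infinite_embeds_omega]).  For a basic open set [U] that meets [c],
    recursion defines a decreasing sequence of basic open sets that meet [c]:
    the first is [U], and each next one is the first, in a fixed enumeration of
    the base, that lies inside the previous one and whose closure is small
    enough.  By Cantor completeness the closures of their traces on [c] have
    exactly one common point, the limit of [U].  The limits form a countable
    subset of [c].  It is infinite: otherwise some point of [c] that is not a
    limit has a basic neighbourhood [W] whose closure avoids the finitely many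
    limits, whereas the limit of [W] lies in the closure of [W].  Therefore
    [UIC] implies [IDI]: an infinite set is either countable, and then omega
    embeds into it, or it contains an infinite closed set.

    All of this happens inside a model of ZF, where sets are given by
    separation for formulas.  The predicate [definable] and the tactic [def]
    take care of the formulas: a predicate of the metatheory built from
    membership, equality, connectives, quantifiers over the model, parameters
    and definite descriptions ([the]) is definable. *)

Existing Class is_ZF_model.

(** * First-order definability *)

Section Definability.
Context {V : set_structure}.
Implicit Types (P Q : (nat -> V) -> Prop) (e a b : nat -> V) (s : (nat -> V) -> V).

(** The renaming [r] under a binder. *)
Definition lift_ren (r : nat -> nat) (n : nat) : nat :=
  match n with 0 => 0 | S m => S (r m) end.

Fixpoint rename (r : nat -> nat) (p : formula) : formula :=
  match p with
  | FMem i j => FMem (r i) (r j)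
  | FEq i j => FEq (r i) (r j)
  | FFalse => FFalse
  | FImp p q => FImp (rename r p) (rename r q)
  | FAnd p q => FAnd (rename r p) (rename r q)
  | FOr p q => FOr (rename r p) (rename r q)
  | FAll p => FAll (rename (lift_ren r) p)
  | FEx p => FEx (rename (lift_ren r) p)
  end.

Lemma sat_rename p : forall r e e',
  (forall n, e' n = e (r n)) -> sat e (rename r p) <-> sat e' p.
Proof.
  induction p; simpl; intros r e e' H; rewrite ?H; try tauto.
  - rewrite (IHp1 r e e' H), (IHp2 r e e' H); tauto.
  - rewrite (IHp1 r e e' H), (IHp2 r e e' H); tauto.
  - rewrite (IHp1 r e e' H), (IHp2 r e e' H); tauto.
  - assert (K : forall x, sat (scons x e) (rename (lift_ren r) p) <->
                          sat (scons x e') p)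
      by (intros x; apply IHp; intros [|n]; simpl; auto).
    split; intros G x; apply K, G.
  - assert (K : forall x, sat (scons x e) (rename (lift_ren r) p) <->
                          sat (scons x e') p)
      by (intros x; apply IHp; intros [|n]; simpl; auto).
    split; intros [x G]; exists x; apply K, G.
Qed.

(** The assignment with the values of [e] at even and those of [a] at odd
    indices. *)
Definition interleave e a (n : nat) : V :=
  if Nat.even n then e (Nat.div2 n) else a (Nat.div2 n).

Lemma interleave_even e a n : interleave e a (2 * n) = e n.
Proof. unfold interleave; rewrite Nat.even_even, Nat.div2_double; auto. Qed.

Lemma interleave_odd e a n : interleave e a (S (2 * n)) = a n.
Proof.
  unfold interleave.
  rewrite Nat.even_succ, Nat.odd_even, Nat.div2_succ_double; auto.
Qed.

(** A predicate on assignments is definable if it is given by a formula of set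
    theory with parameters: the formula reads the assignment at the even
    variables and the parameters at the odd ones. *)
Definition definable P : Prop :=
  exists p a, forall e, P e <-> sat (interleave e a) p.

Lemma double_cases n : (exists k, n = 2 * k) \/ (exists k, n = S (2 * k)).
Proof.
  destruct (Nat.Even_or_Odd n) as [[k ->]|[k ->]]; [left | right]; exists k;
    rewrite ?Nat.add_1_r; auto.
Qed.

(** The renaming by [r] of the variables proper and by [s] of the parameters. *)
Definition on_vars (r s : nat -> nat) (n : nat) : nat :=
  if Nat.even n then 2 * r (Nat.div2 n) else S (2 * s (Nat.div2 n)).

Lemma sat_on_vars p (r s : nat -> nat) e a e' a' :
  (forall n, e' n = e (r n)) -> (forall n, a' n = a (s n)) ->
  sat (interleave e a) (rename (on_vars r s) p) <-> sat (interleave e' a') p.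
Proof.
  intros He Ha; apply sat_rename; intros n.
  unfold on_vars.
  destruct (double_cases n) as [[k ->]|[k ->]].
  - rewrite Nat.even_even, Nat.div2_double, !interleave_even; auto.
  - rewrite Nat.even_succ, Nat.odd_even, Nat.div2_succ_double, !interleave_odd;
      auto.
Qed.

Lemma definable_iff P Q :
  (forall e, P e <-> Q e) -> definable Q -> definable P.
Proof.
  intros H (p & a & K); exists p, a; intros e; rewrite H; apply K.
Qed.

Lemma definable_ren (r : nat -> nat) P :
  definable P -> definable (fun e => P (fun n => e (r n))).
Proof.
  intros (p & a & H).
  exists (rename (on_vars r (fun n => n)) p), a; intros e.
  rewrite H; symmetry; apply sat_on_vars; auto.
Qed.

(** Two definable predicates can be given with the same parameters. *)
Lemma definable_common P Q : definable P -> definable Q ->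
  exists p q c, (forall e, P e <-> sat (interleave e c) p) /\
                (forall e, Q e <-> sat (interleave e c) q).
Proof.
  intros (p & a & Hp) (q & b & Hq).
  exists (rename (on_vars (fun n => n) (fun n => 2 * n)) p),
         (rename (on_vars (fun n => n) (fun n => S (2 * n))) q), (interleave a b).
  split; intros e; rewrite ?Hp, ?Hq; symmetry; apply sat_on_vars; auto;
    intros n; rewrite ?interleave_even, ?interleave_odd; auto.
Qed.


Context {ZF : is_ZF_model V}.

Lemma ZF_inhabited : inhabited V.
Proof. destruct (zf_infinity ZF) as [a _]; exact (inhabits a). Qed.

(** Classically a closed statement of the metatheory is true or false, hence
    definable. *)
Lemma def_const (A : Prop) : definable (fun _ => A).
Proof.
  destruct ZF_inhabited as [v].
  destruct (classic A) as [H|H].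
  - exists (FImp FFalse FFalse), (fun _ => v); simpl; tauto.
  - exists FFalse, (fun _ => v); simpl; tauto.
Qed.

Lemma def_imp P Q :
  definable P -> definable Q -> definable (fun e => P e -> Q e).
Proof.
  intros HP HQ; destruct (definable_common HP HQ) as (p & q & c & Hp & Hq).
  exists (FImp p q), c; intros e; simpl; rewrite Hp, Hq; tauto.
Qed.

Lemma def_and P Q :
  definable P -> definable Q -> definable (fun e => P e /\ Q e).
Proof.
  intros HP HQ; destruct (definable_common HP HQ) as (p & q & c & Hp & Hq).
  exists (FAnd p q), c; intros e; simpl; rewrite Hp, Hq; tauto.
Qed.

Lemma def_or P Q :
  definable P -> definable Q -> definable (fun e => P e \/ Q e).
Proof.
  intros HP HQ; destruct (definable_common HP HQ) as (p & q & c & Hp & Hq).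
  exists (FOr p q), c; intros e; simpl; rewrite Hp, Hq; tauto.
Qed.

(** Renaming that moves a newly bound variable to the even variable [0]. *)
Definition bind_ren (n : nat) : nat :=
  if Nat.even n then match n with 0 => 0 | S m => m end else S n.

Lemma sat_bind p e a x :
  sat (scons x (interleave e a)) (rename bind_ren p) <->
  sat (interleave (scons x e) a) p.
Proof.
  apply sat_rename; intros n; unfold bind_ren.
  destruct (double_cases n) as [[k ->]|[k ->]].
  - rewrite Nat.even_even, interleave_even.
    destruct k as [|k]; simpl; auto.
    rewrite Nat.add_succ_r; simpl.
    change (e k = interleave e a (2 * k)); rewrite interleave_even; auto.
  - rewrite Nat.even_succ, Nat.odd_even, interleave_odd.
    change (a k = interleave e a (S (2 * k))); rewrite interleave_odd; auto.
Qed.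

Lemma def_ex (P : V -> (nat -> V) -> Prop) :
  definable (fun e => P (e 0) (fun n => e (S n))) ->
  definable (fun e => exists x, P x e).
Proof.
  intros (p & a & H).
  exists (FEx (rename bind_ren p)), a; intros e; simpl.
  split; intros [x K]; exists x;
    apply sat_bind || apply sat_bind in K; apply (H (scons x e)); exact K.
Qed.

Lemma def_all (P : V -> (nat -> V) -> Prop) :
  definable (fun e => P (e 0) (fun n => e (S n))) ->
  definable (fun e => forall x, P x e).
Proof.
  intros (p & a & H).
  exists (FAll (rename bind_ren p)), a; intros e; simpl.
  split; intros K x; specialize (K x);
    apply sat_bind || apply sat_bind in K; apply (H (scons x e)); exact K.
Qed.

(** Terms: functions of an assignment with a definable graph. *)
Definition deft (s : (nat -> V) -> V) : Prop :=
  definable (fun e => e 0 = s (fun n => e (S n))).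

Lemma definable_0_eq_S k : definable (fun e => e 0 = e (S k)).
Proof.
  destruct ZF_inhabited as [v].
  exists (FEq 0 (2 * S k)), (fun _ => v); intros e; unfold sat.
  rewrite interleave_even; change 0 with (2 * 0); rewrite interleave_even.
  tauto.
Qed.

Lemma deft_var k : deft (fun e => e k).
Proof. apply definable_0_eq_S. Qed.

Lemma deft_const c : deft (fun _ => c).
Proof.
  exists (FEq 0 1), (fun _ => c); intros e; simpl.
  change 0 with (2 * 0); rewrite interleave_even.
  change 1 with (S (2 * 0)); rewrite interleave_odd; tauto.
Qed.

Lemma deft_shift s : deft s -> deft (fun e => s (fun n => e (S n))).
Proof.
  intros H.
  exact (definable_ren (fun n => match n with 0 => 0 | S m => S (S m) end) H).
Qed.

(** Definability of predicates and operations with one, two or three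
    arguments. *)
Definition def1 (R : V -> Prop) : Prop := definable (fun e => R (e 0)).
Definition def2 (R : V -> V -> Prop) : Prop :=
  definable (fun e => R (e 0) (e 1)).
Definition def3 (R : V -> V -> V -> Prop) : Prop :=
  definable (fun e => R (e 0) (e 1) (e 2)).
Definition deft1 (F : V -> V) : Prop := deft (fun e => F (e 0)).
Definition deft2 (F : V -> V -> V) : Prop := deft (fun e => F (e 0) (e 1)).

Lemma def3_app R s s' s'' : def3 R -> deft s -> deft s' -> deft s'' ->
  definable (fun e => R (s e) (s' e) (s'' e)).
Proof.
  intros H Hs Hs' Hs''.
  apply (@definable_iff _ (fun e => exists x, x = s e /\
           exists y, y = s' e /\ exists z, z = s'' e /\ R x y z)).
  { intros e; split.
    - intros K; repeat (eexists; split; [reflexivity|]); exact K.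
    - intros (x & -> & y & -> & z & -> & K); exact K. }
  apply def_ex, def_and; [exact Hs|].
  apply def_ex, def_and; [exact (deft_shift Hs')|].
  apply def_ex, def_and; [exact (deft_shift (deft_shift Hs''))|].
  exact (definable_ren
    (fun n => match n with 0 => 2 | 1 => 1 | 2 => 0 | m => m end) H).
Qed.

Lemma def2_app R s s' : def2 R -> deft s -> deft s' ->
  definable (fun e => R (s e) (s' e)).
Proof.
  intros H Hs Hs'; exact (@def3_app (fun x y _ => R x y) s s' s' H Hs Hs' Hs').
Qed.

Lemma def1_app R s : def1 R -> deft s -> definable (fun e => R (s e)).
Proof. intros H Hs; exact (@def2_app (fun x _ => R x) s s H Hs Hs). Qed.

Lemma deft2_app F s s' : deft2 F -> deft s -> deft s' ->
  deft (fun e => F (s e) (s' e)).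
Proof.
  intros H Hs Hs'.
  exact (@def3_app (fun y x x' => y = F x x') (fun e => e 0) _ _ H
           (deft_var 0) (deft_shift Hs) (deft_shift Hs')).
Qed.

Lemma deft1_app F s : deft1 F -> deft s -> deft (fun e => F (s e)).
Proof. intros H Hs; exact (@deft2_app (fun x _ => F x) s s H Hs Hs). Qed.

Lemma def_eq s s' : deft s -> deft s' -> definable (fun e => s e = s' e).
Proof. apply (@def2_app (fun x y => x = y)), (definable_0_eq_S 0). Qed.

Lemma def_mem s s' : deft s -> deft s' -> definable (fun e => s e ∈ s' e).
Proof.
  apply (@def2_app (fun x y => x ∈ y)).
  destruct ZF_inhabited as [v].
  exists (FMem (2 * 0) (2 * 1)), (fun _ => v); intros e; unfold sat.
  rewrite !interleave_even; tauto.
Qed.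

(** Definite description: the unique set satisfying [P] if there is one, and
    the empty set otherwise.  The choice operator of the metatheory only gives a
    name to an object that is already unique, so that [the] preserves
    definability ([deft_the]). *)
Definition the_spec (P : V -> Prop) (y : V) : Prop :=
  (P y /\ forall z, P z -> z = y) \/
  ((~ exists x, P x /\ forall z, P z -> z = x) /\ is_empty y).

Definition the (P : V -> Prop) : V := epsilon ZF_inhabited (the_spec P).

Lemma the_spec_unique (P : V -> Prop) y z : the_spec P y -> the_spec P z -> y = z.
Proof.
  intros [[Hy Uy]|[Ny Ey]] [[Hz Uz]|[Nz Ez]]; auto.
  - destruct Nz; eauto.
  - destruct Ny; eauto.
  - apply (zf_extensionality ZF); intros x; split; intros K.
    + destruct (Ey _ K).
    + destruct (Ez _ K).
Qed.

Lemma the_specP (P : V -> Prop) : the_spec P (the P).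
Proof.
  unfold the; apply epsilon_spec.
  destruct (classic (exists x, P x /\ forall z, P z -> z = x)) as [[x H]|H].
  - exists x; left; exact H.
  - destruct (zf_infinity ZF) as (_ & (z & Hz & _) & _).
    exists z; right; auto.
Qed.

Lemma the_eq (P : V -> Prop) y : P y -> (forall z, P z -> z = y) -> the P = y.
Proof.
  intros H U; apply (the_spec_unique (P := P)); [apply the_specP|left; auto].
Qed.

Lemma deft_the (P : (nat -> V) -> V -> Prop) :
  definable (fun e => P (fun n => e (S n)) (e 0)) -> deft (fun e => the (P e)).
Proof.
  intros H; unfold deft.
  apply (@definable_iff _ (fun e => the_spec (P (fun n => e (S n))) (e 0))).
  { intros e; split; intros K.
    - rewrite K; apply the_specP.
    - exact (the_spec_unique K (the_specP _)). }
  assert (H' : definable (fun e => P (fun n => e (S (S n))) (e 0)))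
    by exact (definable_ren
      (fun n => match n with 0 => 0 | S m => S (S m) end) H).
  assert (H'' : definable (fun e => P (fun n => e (S (S (S n)))) (e 0)))
    by exact (definable_ren
      (fun n => match n with 0 => 0 | S m => S (S (S m)) end) H).
  apply def_or; apply def_and.
  - exact H.
  - apply def_all, def_imp; [exact H'|apply def_eq; apply deft_var].
  - apply def_imp; [|apply def_const].
    apply def_ex, def_and; [exact H'|].
    apply def_all, def_imp; [exact H''|apply def_eq; apply deft_var].
  - apply def_all, def_imp; [|apply def_const].
    apply def_mem; apply deft_var.
Qed.
End Definability.

(** Proves definability goals by recursion on the structure of the predicate;
    defined notions are unfolded by unification. *)
Ltac def_step :=
  match goal with
  | |- definable (fun _ => ?A) => exact (def_const A)
  | |- deft (fun _ => ?c) => exact (deft_const c)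
  | |- deft (fun e => e ?k) => exact (deft_var k)
  | H : def1 ?R |- definable (fun e => ?R _) => apply (def1_app H)
  | H : def2 ?R |- definable (fun e => ?R _ _) => apply (def2_app H)
  | H : def3 ?R |- definable (fun e => ?R _ _ _) => apply (def3_app H)
  | H : deft1 ?F |- deft (fun e => ?F _) => apply (deft1_app H)
  | H : deft2 ?F |- deft (fun e => ?F _ _) => apply (deft2_app H)
  | |- definable (fun e => _ ∈ _) => apply def_mem
  | |- definable (fun e => _ = _) => apply def_eq
  | |- definable (fun e => _ /\ _) => apply def_and
  | |- definable (fun e => _ \/ _) => apply def_or
  | |- definable (fun e => ex _) => apply def_ex
  | |- definable _ =>
      first [apply def_all | apply def_imp | apply def_and | apply def_ex
            | apply def_or]
  | |- deft _ => apply deft_the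
  end.

Ltac def :=
  try unfold def1; try unfold def2; try unfold def3;
  try unfold deft1; try unfold deft2;
  repeat (cbv beta; def_step).

(** * Sets, pairs and functions of the model *)

Section Sets.
Context {V : set_structure} {ZF : is_ZF_model V}.

Lemma set_ext (a b : V) : (forall x, x ∈ a <-> x ∈ b) -> a = b.
Proof. apply (zf_extensionality ZF). Qed.

Lemma separation (P : V -> Prop) (a : V) : def1 P ->
  exists b, forall x, x ∈ b <-> x ∈ a /\ P x.
Proof.
  intros (p & c & H).
  destruct (zf_separation ZF (rename bind_ren p)
              (interleave (fun _ => a) c) a) as [b Hb].
  exists b; intros x; rewrite Hb.
  rewrite sat_bind, <- (H (scons x (fun _ => a))); reflexivity.
Qed.

Lemma in_the (P : V -> Prop) : (exists b : V, forall x, x ∈ b <-> P x) ->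
  forall x, x ∈ the (fun b => forall x, x ∈ b <-> P x) <-> P x.
Proof.
  intros [b Hb].
  rewrite (the_eq (P := fun b => forall x, x ∈ b <-> P x) (y := b)); auto.
  intros z Hz; apply set_ext; intros x; rewrite Hz, Hb; tauto.
Qed.

(** The subset of [a] given by [P]; meaningful for definable [P] only. *)
Definition sep (a : V) (P : V -> Prop) : V :=
  the (fun b => forall x, x ∈ b <-> x ∈ a /\ P x).

Lemma in_sep a P x : def1 P -> x ∈ sep a P <-> x ∈ a /\ P x.
Proof.
  intros H; apply (in_the (P := fun x => x ∈ a /\ P x)), separation, H.
Qed.

Definition empty : V := the (fun b => forall x, x ∈ b <-> False).

Lemma not_in_empty x : x ∉ empty.
Proof.
  intros H; refine (proj1 (in_the (P := fun _ => False) _ x) H).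
  destruct (zf_infinity ZF) as (_ & (z & Hz & _) & _).
  exists z; intros y; split; [apply Hz|tauto].
Qed.

Lemma is_empty_iff z : is_empty z <-> z = empty.
Proof.
  split; [|intros ->; intros x; apply not_in_empty].
  intros H; apply set_ext; intros x; split; intros K.
  - destruct (H _ K).
  - destruct (not_in_empty K).
Qed.

Definition upair (x y : V) : V := the (fun b => is_upair b x y).

Lemma in_upair x y z : z ∈ upair x y <-> z = x \/ z = y.
Proof. apply (in_the (P := fun z => z = x \/ z = y)), (zf_pairing ZF). Qed.

Lemma is_upair_iff z x y : is_upair z x y <-> z = upair x y.
Proof.
  split; [|intros ->; intros w; apply in_upair].
  intros H; apply set_ext; intros w; rewrite (H w), in_upair; tauto.
Qed.

Definition bigunion (a : V) : V := the (fun b => is_union b a).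

Lemma in_bigunion a x : x ∈ bigunion a <-> exists y, x ∈ y /\ y ∈ a.
Proof.
  apply (in_the (P := fun x => exists y, x ∈ y /\ y ∈ a)), (zf_union ZF).
Qed.

Definition power (a : V) : V := the (fun b => is_powerset b a).

Lemma in_power a x : x ∈ power a <-> x ⊆ a.
Proof. apply (in_the (P := fun x => x ⊆ a)), (zf_powerset ZF). Qed.

Definition cap (a b : V) : V := sep a (fun x => x ∈ b).

Lemma in_cap a b x : x ∈ cap a b <-> x ∈ a /\ x ∈ b.
Proof. unfold cap; rewrite in_sep by def; reflexivity. Qed.

Definition diff (a b : V) : V := sep a (fun x => x ∉ b).

Lemma in_diff a b x : x ∈ diff a b <-> x ∈ a /\ x ∉ b.
Proof. unfold diff; rewrite in_sep by def; reflexivity. Qed.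

Definition succ (x : V) : V := the (fun b => is_succ b x).

Lemma in_succ x w : w ∈ succ x <-> w ∈ x \/ w = x.
Proof.
  apply (in_the (P := fun w => w ∈ x \/ w = x)).
  exists (bigunion (upair x (upair x x))); intros y; rewrite in_bigunion.
  split.
  - intros (z & Hy & Hz); apply in_upair in Hz as [-> | ->]; auto.
    apply in_upair in Hy as [-> | ->]; auto.
  - intros [H | ->]; [exists x | exists (upair x x)]; rewrite !in_upair; auto.
Qed.

Lemma is_succ_iff s x : is_succ s x <-> s = succ x.
Proof.
  split; [|intros ->; intros w; apply in_succ].
  intros H; apply set_ext; intros w; rewrite (H w), in_succ; tauto.
Qed.

Definition pair (x y : V) : V := the (fun p => is_pair p x y).

Lemma in_pair x y z : z ∈ pair x y <-> z = upair x x \/ z = upair x y.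
Proof.
  assert (E : exists p : V, is_pair p x y).
  { exists (upair (upair x x) (upair x y)); intros w.
    rewrite in_upair, !is_upair_iff; tauto. }
  rewrite (in_the (P := fun z => is_upair z x x \/ is_upair z x y)) by exact E.
  rewrite !is_upair_iff; tauto.
Qed.

Lemma is_pair_iff p x y : is_pair p x y <-> p = pair x y.
Proof.
  split.
  - intros H; apply set_ext; intros w.
    rewrite (H w), in_pair, !is_upair_iff; tauto.
  - intros -> w; rewrite in_pair, !is_upair_iff; tauto.
Qed.

Lemma deft2_pair : deft2 pair.
Proof. def. Qed.

Lemma upair_eq x y x' y' : upair x y = upair x' y' ->
  (x = x' \/ x = y') /\ (y = x' \/ y = y') /\
  (x' = x \/ x' = y) /\ (y' = x \/ y' = y).
Proof.
  intros H.
  assert (K : forall z, z = x \/ z = y <-> z = x' \/ z = y')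
    by (intros z; rewrite <- !in_upair, H; tauto).
  repeat split; apply K; auto.
Qed.

Lemma pair_inj x y x' y' : pair x y = pair x' y' -> x = x' /\ y = y'.
Proof.
  intros H.
  assert (H1 : upair x x ∈ pair x' y') by (rewrite <- H; apply in_pair; auto).
  assert (H2 : upair x y ∈ pair x' y') by (rewrite <- H; apply in_pair; auto).
  assert (H3 : upair x' y' ∈ pair x y) by (rewrite H; apply in_pair; auto).
  clear H; apply in_pair in H1, H2, H3.
  assert (E : x = x')
    by (destruct H1 as [H1|H1]; apply upair_eq in H1 as (_ & _ & [E|E] & _); auto).
  subst x'; split; auto; clear H1.
  assert (E2 : y = x \/ y = y')
    by (destruct H2 as [E|E]; apply upair_eq in E; tauto).
  assert (E3 : y' = x \/ y' = y)
    by (destruct H3 as [E|E]; apply upair_eq in E; tauto).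
  destruct E2, E3; congruence.
Qed.

Lemma related_iff f x y : related f x y <-> pair x y ∈ f.
Proof.
  split.
  - intros (p & Hp & H); apply is_pair_iff in Hp as ->; exact H.
  - intros H; exists (pair x y); rewrite is_pair_iff; auto.
Qed.

Definition prod (a b : V) : V :=
  sep (power (power (bigunion (upair a b))))
    (fun p => exists x y, x ∈ a /\ y ∈ b /\ p = pair x y).

Lemma in_prod a b p :
  p ∈ prod a b <-> exists x y, x ∈ a /\ y ∈ b /\ p = pair x y.
Proof.
  unfold prod; rewrite in_sep by def; split; [tauto|].
  intros H; split; auto.
  destruct H as (x & y & Hx & Hy & ->).
  apply in_power; intros z Hz; apply in_power; intros w Hw.
  apply in_bigunion; apply in_pair in Hz as [-> | ->];
    apply in_upair in Hw as [-> | ->];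
    solve [exists a; rewrite in_upair; auto | exists b; rewrite in_upair; auto].
Qed.

Lemma pair_in_prod a b x y : pair x y ∈ prod a b <-> x ∈ a /\ y ∈ b.
Proof.
  rewrite in_prod; split.
  - intros (x' & y' & Hx & Hy & E); apply pair_inj in E as [-> ->]; auto.
  - intros [Hx Hy]; eauto.
Qed.

Lemma is_product_iff c a b : is_product c a b <-> c = prod a b.
Proof.
  assert (K : forall p, (exists x y, x ∈ a /\ y ∈ b /\ is_pair p x y) <->
                        p ∈ prod a b).
  { intros p; rewrite in_prod.
    split; intros (x & y & Hx & Hy & E); apply is_pair_iff in E; eauto. }
  split.
  - intros H; apply set_ext; intros p; rewrite (H p); apply K.
  - intros -> p; rewrite K; tauto.
Qed.

(** The value [f(x)] of a function of the model; the empty set if [x] is not in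
    the domain of [f]. *)
Definition app (f x : V) : V := the (fun y => related f x y).

Lemma related_app f a b x y : is_fun f a b ->
  related f x y <-> x ∈ a /\ y = app f x.
Proof.
  intros [H1 H2].
  assert (K : x ∈ a -> forall y, related f x y <-> y = app f x).
  { intros Hx; destruct (H2 x Hx) as (z & Hz & U).
    assert (E : app f x = z)
      by (apply (the_eq (P := fun y => related f x y)); auto;
          intros w Hw; symmetry; apply U, Hw).
    rewrite E; intros w; split; [intros Hw; symmetry; apply U, Hw|].
    intros ->; auto. }
  split; [|intros [Hx E]; apply K; auto].
  intros H; assert (Hx : x ∈ a); [|split; auto; apply K; auto].
  apply related_iff in H; destruct (H1 _ H) as (x' & y' & Hx & _ & E).
  apply is_pair_iff, pair_inj in E as [-> _]; exact Hx.
Qed.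

Lemma app_in f a b x : is_fun f a b -> x ∈ a -> app f x ∈ b.
Proof.
  intros H Hx; assert (K := proj2 (related_app x (app f x) H) (conj Hx eq_refl)).
  apply related_iff in K; destruct (proj1 H _ K) as (x' & y' & _ & Hy & E).
  apply is_pair_iff, pair_inj in E as [_ ->]; exact Hy.
Qed.

(** A definable functional relation between two sets is a function of the
    model. *)
Lemma exists_fun_rel (R : V -> V -> Prop) (a b : V) : def2 R ->
  (forall x, x ∈ a -> exists! y, y ∈ b /\ R x y) ->
  exists f, is_fun f a b /\ forall x, x ∈ a -> R x (app f x).
Proof.
  intros D H.
  set (f := sep (prod a b) (fun p => exists x y, p = pair x y /\ R x y)).
  assert (Hf : forall x y, related f x y <-> x ∈ a /\ y ∈ b /\ R x y).
  { intros x y; rewrite related_iff; unfold f; rewrite in_sep by def.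
    rewrite pair_in_prod; split.
    - intros (K & x' & y' & E & K').
      apply pair_inj in E as [-> ->]; tauto.
    - intros (Hx & Hy & K); split; eauto. }
  assert (F : is_fun f a b).
  { split.
    - intros p Hp; unfold f in Hp; rewrite in_sep in Hp by def.
      destruct Hp as [Hp _]; apply in_prod in Hp as (x & y & Hx & Hy & ->).
      exists x, y; rewrite is_pair_iff; auto.
    - intros x Hx; destruct (H x Hx) as (y & [Hy K] & U).
      exists y; split; [apply Hf; auto|].
      intros z Hz; apply U; apply Hf in Hz; tauto. }
  exists f; split; auto.
  intros x Hx; apply (Hf x), (related_app _ _ F); auto.
Qed.

Lemma exists_fun (G : V -> V) (a b : V) : deft1 G ->
  (forall x, x ∈ a -> G x ∈ b) ->
  exists f, is_fun f a b /\ forall x, x ∈ a -> app f x = G x.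
Proof.
  intros D H; apply (exists_fun_rel (R := fun x y => y = G x)); [def|].
  intros x Hx; exists (G x); split; [auto|intros y [_ ->]; auto].
Qed.

(** [f] is an injective function of the model from [a] to [b]. *)
Definition is_inj (f a b : V) : Prop :=
  is_fun f a b /\
  forall x y, x ∈ a -> y ∈ a -> app f x = app f y -> x = y.

Definition embeds (a b : V) : Prop := exists f, is_inj f a b.

Lemma exists_inj (G : V -> V) (a b : V) : deft1 G ->
  (forall x, x ∈ a -> G x ∈ b) ->
  (forall x y, x ∈ a -> y ∈ a -> G x = G y -> x = y) -> embeds a b.
Proof.
  intros D H I; destruct (exists_fun D H) as (f & Hf & E).
  exists f; split; auto.
  intros x y Hx Hy; rewrite !E by auto; auto.
Qed.

Lemma embeds_trans a b c : embeds a b -> embeds b c -> embeds a c.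
Proof.
  intros (f & Hf & If) (g & Hg & Ig).
  apply (exists_inj (G := fun x => app g (app f x))); [def| |].
  - intros x Hx; apply (app_in Hg), (app_in Hf), Hx.
  - intros x y Hx Hy E; apply If, Ig; auto; apply (app_in Hf); auto.
Qed.

Lemma embeds_subset a b : a ⊆ b -> embeds a b.
Proof. intros H; apply (exists_inj (G := fun x => x)); [def|apply H|auto]. Qed.

(** A definable relation that is a bijection from [a] to [b]. *)
Lemma equipotent_intro (R : V -> V -> Prop) (a b : V) : def2 R ->
  (forall x, x ∈ a -> exists! y, y ∈ b /\ R x y) ->
  (forall y, y ∈ b -> exists! x, x ∈ a /\ R x y) -> equipotent a b.
Proof.
  intros D H1 H2; destruct (exists_fun_rel D H1) as (f & Hf & K).
  exists f; split; auto.
  assert (E : forall x y, y ∈ b -> (x ∈ a /\ related f x y <-> x ∈ a /\ R x y)).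
  { intros x y Hy; rewrite (related_app _ _ Hf).
    split; [intros (Hx & _ & ->); auto|].
    intros [Hx Hxy]; repeat split; auto.
    destruct (H1 x Hx) as (z & _ & U).
    rewrite <- (U y), <- (U (app f x)); auto.
    split; auto; apply (app_in Hf), Hx. }
  intros y Hy; destruct (H2 y Hy) as (x & Hx & U).
  exists x; split; [apply E; auto|].
  intros x' Hx'; apply U, E; auto.
Qed.

Lemma equipotent_fun (G : V -> V) (a b : V) : deft1 G ->
  (forall x, x ∈ a -> G x ∈ b) ->
  (forall x y, x ∈ a -> y ∈ a -> G x = G y -> x = y) ->
  (forall y, y ∈ b -> exists x, x ∈ a /\ y = G x) -> equipotent a b.
Proof.
  intros D H I S; apply (equipotent_intro (R := fun x y => y = G x)); [def| |].
  - intros x Hx; exists (G x); split; [auto|intros y [_ ->]; auto].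
  - intros y Hy; destruct (S y Hy) as (x & Hx & ->).
    exists x; split; auto; intros x' [Hx' E]; auto.
Qed.

Lemma equipotent_elim (a b : V) : equipotent a b ->
  exists f, is_inj f a b /\ forall y, y ∈ b -> exists x, x ∈ a /\ y = app f x.
Proof.
  intros (f & Hf & H); exists f; repeat split; try apply Hf.
  - intros x y Hx Hy E.
    destruct (H (app f x) (app_in Hf Hx)) as (z & _ & U).
    rewrite <- (U x), <- (U y); auto; split; auto;
      apply (related_app _ _ Hf); auto.
  - intros y Hy; destruct (H y Hy) as (x & [Hx K] & _).
    exists x; split; auto; apply (related_app _ _ Hf) in K; tauto.
Qed.

Lemma equipotent_embeds (a b : V) : equipotent a b -> embeds a b.
Proof. intros H; destruct (equipotent_elim H) as (f & Hf & _); exists f; auto. Qed.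

Lemma equipotent_trans (a b c : V) : equipotent a b -> equipotent b c -> equipotent a c.
Proof.
  intros H H'; destruct (equipotent_elim H) as (f & [Hf If] & Sf).
  destruct (equipotent_elim H') as (g & [Hg Ig] & Sg).
  apply (equipotent_fun (G := fun x => app g (app f x))); [def| | |].
  - intros x Hx; apply (app_in Hg), (app_in Hf), Hx.
  - intros x y Hx Hy E; apply If, Ig; auto; apply (app_in Hf); auto.
  - intros z Hz; destruct (Sg z Hz) as (y & Hy & ->).
    destruct (Sf y Hy) as (x & Hx & ->); eauto.
Qed.

(** An injection is a bijection onto its range. *)
Lemma is_inj_range f a b : is_inj f a b ->
  equipotent a (sep b (fun y => exists x, x ∈ a /\ y = app f x)).
Proof.
  intros [Hf I]; apply (equipotent_fun (G := fun x => app f x)); [def| |auto|].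
  - intros x Hx; rewrite in_sep by def; split; eauto; apply (app_in Hf), Hx.
  - intros y Hy; rewrite in_sep in Hy by def; tauto.
Qed.
End Sets.

(** * Natural numbers *)

Section Naturals.
Context {V : set_structure} {ZF : is_ZF_model V}.

Lemma mem_asym (x y : V) : x ∈ y -> y ∉ x.
Proof.
  intros H H'; destruct (@zf_foundation V ZF (upair x y)) as (z & Hz & K).
  - exists x; apply in_upair; auto.
  - apply in_upair in Hz as [-> | ->].
    + apply (K y); auto; apply in_upair; auto.
    + apply (K x); auto; apply in_upair; auto.
Qed.

Lemma mem_irrefl (x : V) : x ∉ x.
Proof. intros H; exact (mem_asym H H). Qed.

Lemma inductive_iff (a : V) :
  inductive a <-> empty ∈ a /\ forall x, x ∈ a -> succ x ∈ a.
Proof.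
  split.
  - intros [(z & Hz & H0) H1].
    apply is_empty_iff in Hz as ->; split; auto.
    intros x Hx; destruct (H1 x Hx) as (s & Hs & K).
    apply is_succ_iff in Hs as ->; auto.
  - intros [H0 H1]; split.
    + exists empty; rewrite is_empty_iff; auto.
    + intros x Hx; exists (succ x); rewrite is_succ_iff; auto.
Qed.

Definition omega : V := the (fun w => is_omega w).

Lemma is_omega_omega : is_omega omega.
Proof.
  destruct (zf_infinity ZF) as [a Ha].
  set (w := sep a (fun x => forall v, inductive v -> x ∈ v)).
  assert (Hw : forall x, x ∈ w <-> x ∈ a /\ forall v, inductive v -> x ∈ v)
    by (intros x; unfold w; rewrite in_sep by def; reflexivity).
  assert (K : is_omega w).
  { split.
    - apply inductive_iff; split.
      + apply Hw; split; [apply inductive_iff, Ha|].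
        intros v Hv; apply inductive_iff, Hv.
      + intros x Hx; apply Hw in Hx as [Hx Hx']; apply Hw; split.
        * apply inductive_iff; auto.
        * intros v Hv; apply inductive_iff; auto.
    - intros v Hv x Hx; apply Hw in Hx as [_ Hx]; auto. }
  unfold omega; rewrite (the_eq (P := fun w => is_omega w) K); auto.
  intros z Hz; apply set_ext; intros x; split.
  - apply Hz, K.
  - apply K, Hz.
Qed.

Lemma is_omega_iff (w : V) : is_omega w <-> w = omega.
Proof.
  assert (K := is_omega_omega); split; [|intros ->; auto].
  intros H; apply set_ext; intros x; split; [apply H, K|apply K, H].
Qed.

Lemma empty_omega : empty ∈ omega.
Proof. apply inductive_iff, is_omega_omega. Qed.

Lemma succ_omega n : n ∈ omega -> succ n ∈ omega.
Proof. apply inductive_iff, is_omega_omega. Qed.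

Lemma omega_ind (P : V -> Prop) : def1 P -> P empty ->
  (forall n, n ∈ omega -> P n -> P (succ n)) -> forall n, n ∈ omega -> P n.
Proof.
  intros D H0 H1 n Hn.
  assert (K : n ∈ sep omega P); [|rewrite in_sep in K by auto; tauto].
  apply (proj2 is_omega_omega); auto.
  apply inductive_iff; split.
  - rewrite in_sep by auto; auto using empty_omega.
  - intros x; rewrite !in_sep by auto; intros []; auto using succ_omega.
Qed.

End Naturals.

(** Induction on the natural numbers of the model for a goal of the form
    [forall n, n ∈ omega -> P n]. *)
Ltac omega_induction :=
  match goal with
  | |- forall n, n ∈ omega -> @?P n =>
      apply (omega_ind (P := P)); [def| |]; cbv beta
  end.

Section Arithmetic.
Context {V : set_structure} {ZF : is_ZF_model V}.

Lemma omega_cases n : n ∈ omega ->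
  n = empty \/ exists m, m ∈ omega /\ n = succ m.
Proof.
  revert n; omega_induction; [auto|].
  intros n Hn _; right; exists n; auto.
Qed.

Lemma succ_neq_empty (n : V) : succ n <> empty.
Proof.
  intros H; apply (@not_in_empty V ZF n); rewrite <- H; apply in_succ; auto.
Qed.

Lemma succ_inj (m n : V) : succ m = succ n -> m = n.
Proof.
  intros H.
  assert (A : m ∈ succ n) by (rewrite <- H; apply in_succ; auto).
  assert (B : n ∈ succ m) by (rewrite H; apply in_succ; auto).
  apply in_succ in A as [A|A], B as [B|B]; auto.
  destruct (mem_asym A B).
Qed.

Lemma nat_mem_trans n : n ∈ omega -> forall m k, k ∈ m -> m ∈ n -> k ∈ n.
Proof.
  revert n; omega_induction.
  - intros m k _ H; destruct (not_in_empty H).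
  - intros n Hn IH m k Hk Hm; apply in_succ; left.
    apply in_succ in Hm as [Hm| ->]; eauto.
Qed.

Lemma succ_mem n m : n ∈ omega -> m ∈ n -> succ m ∈ succ n.
Proof.
  intros Hn; revert n Hn m;
    omega_induction.
  - intros m H; destruct (not_in_empty H).
  - intros n Hn IH m Hm; apply in_succ.
    apply in_succ in Hm as [Hm| ->]; auto.
Qed.

Lemma nat_trichotomy n m :
  n ∈ omega -> m ∈ omega -> m ∈ n \/ m = n \/ n ∈ m.
Proof.
  intros Hn; revert n Hn m;
    omega_induction.
  - omega_induction; [auto|].
    intros m Hm [H|[->|H]].
    + destruct (not_in_empty H).
    + right; right; apply in_succ; auto.
    + right; right; apply in_succ; auto.
  - intros n Hn IH m Hm; rewrite in_succ.
    destruct (IH m Hm) as [H|[H|H]]; auto.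
    apply succ_mem in H; auto; apply in_succ in H as [H|H]; auto.
Qed.

Lemma nat_least (P : V -> Prop) : def1 P -> (exists n, n ∈ omega /\ P n) ->
  exists n, n ∈ omega /\ P n /\ forall k, k ∈ omega -> P k -> k ∉ n.
Proof.
  intros D (n & Hn & Pn).
  destruct (@zf_foundation V ZF (sep omega P)) as (x & Hx & K).
  - exists n; rewrite in_sep by auto; auto.
  - rewrite in_sep in Hx by auto; exists x; repeat split; try tauto.
    intros k Hk Pk H; apply (K k H); rewrite in_sep by auto; auto.
Qed.

(** Choice from an enumerated set: the element of [A] with property [P] and
    least index under [h : A -> omega]. *)
Definition pick (h A : V) (P : V -> Prop) : V :=
  the (fun x => x ∈ A /\ P x /\ forall y, y ∈ A -> P y -> app h y ∉ app h x).

Lemma pickP h A (P : V -> Prop) : is_inj h A omega -> def1 P ->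
  (exists x, x ∈ A /\ P x) -> pick h A P ∈ A /\ P (pick h A P).
Proof.
  intros [Hh I] D (x & Hx & Px).
  destruct (@nat_least (fun n => exists x, x ∈ A /\ P x /\ n = app h x))
    as (n & Hn & (y & Hy & Py & ->) & L); [def| |].
  { exists (app h x); split; eauto; apply (app_in Hh Hx). }
  unfold pick; rewrite (the_eq (y := y)); auto.
  - repeat split; auto.
    intros z Hz Pz; apply L; eauto; apply (app_in Hh Hz).
  - intros z (Hz & Pz & Lz); apply I; auto.
    destruct (nat_trichotomy (app_in Hh Hy) (app_in Hh Hz)) as [H|[H|H]]; auto.
    + destruct (L (app h z) (app_in Hh Hz)); eauto.
    + destruct (Lz y Hy Py H).
Qed.

(** [f] is the sequence in [A] with [f(0) = a0] and [f(n + 1) = G n (f(n))]. *)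
Definition is_rec (G : V -> V -> V) (A a0 f : V) : Prop :=
  is_fun f omega A /\ app f empty = a0 /\
  forall n, n ∈ omega -> app f (succ n) = G n (app f n).

(** The graph of the sequence is the least set [r] of pairs that contains
    [(0, a0)] and is closed under [(n, x) |-> (n + 1, G n x)]. *)
Lemma recursion (G : V -> V -> V) (A a0 : V) : deft2 G -> a0 ∈ A ->
  (forall n x, n ∈ omega -> x ∈ A -> G n x ∈ A) -> exists f, is_rec G A a0 f.
Proof.
  intros D H0 HG.
  set (closed_set := fun S => pair empty a0 ∈ S /\ forall n x, n ∈ omega ->
         x ∈ A -> pair n x ∈ S -> pair (succ n) (G n x) ∈ S).
  set (r := sep (prod omega A) (fun p => forall S, closed_set S -> p ∈ S)).
  assert (Hr : forall p, p ∈ r <-> p ∈ prod omega A /\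
                           forall S, closed_set S -> p ∈ S)
    by (intros p; unfold r, closed_set; rewrite in_sep by def; reflexivity).
  assert (R0 : pair empty a0 ∈ r).
  { apply Hr; split; [apply pair_in_prod; auto using empty_omega|].
    intros S [HS _]; exact HS. }
  assert (R1 : forall n x, pair n x ∈ r -> pair (succ n) (G n x) ∈ r).
  { intros n x H; apply Hr in H as [H K]; apply pair_in_prod in H as [Hn Hx].
    apply Hr; split; [apply pair_in_prod; auto using succ_omega|].
    intros S HS; apply HS; auto. }
  (* By minimality every element of [r] has one of the two prescribed forms. *)
  assert (Inv : forall p, p ∈ r -> p = pair empty a0 \/
    exists n x, pair n x ∈ r /\ p = pair (succ n) (G n x)).
  { intros p Hp.
    set (S := sep r (fun p => p = pair empty a0 \/
                exists n x, pair n x ∈ r /\ p = pair (succ n) (G n x))).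
    assert (HS : p ∈ S); [|unfold S in HS; rewrite in_sep in HS by def; tauto].
    apply Hr in Hp as [_ Hp]; apply Hp; unfold S; split.
    - rewrite in_sep by def; auto.
    - intros n x Hn Hx H; rewrite in_sep in H by def; rewrite in_sep by def.
      destruct H as [H _]; split; eauto. }
  assert (U : forall n, n ∈ omega -> exists! x, x ∈ A /\ pair n x ∈ r).
  { omega_induction.
    - exists a0; split; auto; intros x [_ Hx].
      destruct (Inv _ Hx) as [E|(n & y & _ & E)]; apply pair_inj in E as [E E'].
      + auto.
      + destruct (succ_neq_empty (eq_sym E)).
    - intros n Hn (x & [Hx Hnx] & Ux); exists (G n x); split; auto.
      intros y [_ Hy].
      destruct (Inv _ Hy) as [E|(m & z & Hz & E)]; apply pair_inj in E as [E ->].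
      + destruct (succ_neq_empty E).
      + apply succ_inj in E as <-; f_equal; apply Ux; split; auto.
        apply Hr in Hz as [Hz _]; apply pair_in_prod in Hz; tauto. }
  destruct (exists_fun_rel (R := fun n x => pair n x ∈ r) (b := A)
              ltac:(def) U) as (f & Hf & K).
  exists f; split; [exact Hf|split].
  - destruct (U empty empty_omega) as (x & _ & Ux).
    transitivity x; [symmetry|]; apply Ux; auto.
    split; [apply (app_in Hf)|apply K]; apply empty_omega.
  - intros n Hn; destruct (U _ (succ_omega Hn)) as (x & _ & Ux).
    assert (Hx := app_in Hf Hn).
    transitivity x; [symmetry|]; apply Ux; auto.
    split; [apply (app_in Hf)|apply K]; apply succ_omega, Hn.
Qed.

Lemma recursion_unique (G : V -> V -> V) (A a0 f g : V) :
  is_rec G A a0 f -> is_rec G A a0 g ->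
  forall n, n ∈ omega -> app f n = app g n.
Proof.
  intros (_ & F0 & F1) (_ & G0 & G1); omega_induction; [congruence|].
  intros n Hn E; rewrite F1, G1, E; auto.
Qed.

(** * Finite, countable and Dedekind-infinite sets *)

Lemma infinite_iff (a : V) :
  infinite a <-> ~ exists n, n ∈ omega /\ equipotent a n.
Proof.
  unfold infinite; split; intros H K; apply H.
  - destruct K as (n & K); exists omega, n; rewrite is_omega_iff; auto.
  - destruct K as (w & n & K & K'); apply is_omega_iff in K as ->; eauto.
Qed.

Lemma countable_iff (a : V) : countable a <-> embeds a omega.
Proof.
  split.
  - intros (w & s & Hw & Hs & H); apply is_omega_iff in Hw as ->.
    apply (embeds_trans (equipotent_embeds H)), embeds_subset, Hs.
  - intros (f & Hf); eexists; eexists; split; [apply is_omega_omega|].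
    split; [|apply (is_inj_range Hf)].
    intros y Hy; rewrite in_sep in Hy by def; tauto.
Qed.

(** Pigeonhole principle.  An injective sequence [f] in [n + 1] is turned into
    one in [n] by replacing a value [f (k + 1) = n] with [f 0] in the sequence
    [k |-> f (k + 1)]. *)
Lemma omega_not_embeds_nat n : n ∈ omega -> ~ embeds omega n.
Proof.
  revert n; omega_induction.
  - intros (f & Hf & _).
    exact (not_in_empty (app_in Hf empty_omega)).
  - intros n Hn IH (f & Hf & I); apply IH.
    set (R := fun k y => (app f (succ k) = n /\ y = app f empty) \/
                         (app f (succ k) <> n /\ y = app f (succ k))).
    assert (HR : forall k, k ∈ omega -> exists! y, y ∈ n /\ R k y).
    { intros k Hk.
      assert (K := app_in Hf (succ_omega Hk)); apply in_succ in K.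
      destruct (classic (app f (succ k) = n)) as [E|E].
      - exists (app f empty); split; [split; [|left; auto]|].
        + assert (K0 := app_in Hf empty_omega); apply in_succ in K0.
          destruct K0 as [K0|K0]; auto.
          destruct (@succ_neq_empty k); apply I;
            auto using empty_omega, succ_omega; congruence.
        + intros y [_ [[_ ->]|[E' _]]]; congruence.
      - exists (app f (succ k)); split; [split; [tauto|right; auto]|].
        intros y [_ [[E' _]|[_ ->]]]; congruence. }
    destruct (@exists_fun_rel _ _ R omega n ltac:(unfold R; def) HR)
      as (g & Hg & K).
    exists g; split; auto; intros k m Hk Hm E.
    apply succ_inj, I; auto using succ_omega.
    destruct (K k Hk) as [[E1 E2]|[E1 E2]], (K m Hm) as [[E3 E4]|[E3 E4]];
      try congruence.
    + destruct (@succ_neq_empty m); apply I; auto using empty_omega, succ_omega;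
        congruence.
    + destruct (@succ_neq_empty k); apply I; auto using empty_omega, succ_omega;
        congruence.
Qed.

Lemma embeds_omega_infinite (a : V) : embeds omega a -> infinite a.
Proof.
  intros H; apply infinite_iff; intros (n & Hn & K).
  apply (omega_not_embeds_nat Hn), (embeds_trans H), equipotent_embeds, K.
Qed.

Lemma subset_nat_finite n : n ∈ omega -> forall s, s ⊆ n ->
  exists m, m ∈ omega /\ equipotent s m.
Proof.
  revert n; omega_induction.
  - intros s Hs; exists empty; split; [apply empty_omega|].
    apply (equipotent_fun (G := fun x => x)); [def|exact Hs|auto|].
    intros y H; destruct (not_in_empty H).
  - intros n Hn IH s Hs.
    destruct (IH (sep s (fun x => x <> n))) as (m & Hm & E).
    { intros x Hx; rewrite in_sep in Hx by def; destruct Hx as [Hx N].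
      apply Hs, in_succ in Hx; tauto. }
    destruct (classic (n ∈ s)) as [K|K].
    + exists (succ m); split; [apply succ_omega, Hm|].
      destruct (equipotent_elim E) as (f & [Hf I] & S).
      assert (F : forall x, x ∈ s -> x <> n -> x ∈ sep s (fun x => x <> n))
        by (intros; rewrite in_sep by def; auto).
      apply (equipotent_intro (R := fun x y =>
               (x = n /\ y = m) \/ (x <> n /\ y = app f x))); [def| |].
      * intros x Hx; destruct (classic (x = n)) as [->|N].
        -- exists m; split; [split; [apply in_succ|]; tauto|].
           intros y [_ [[_ H]|[H _]]]; congruence.
        -- exists (app f x); split.
           ++ split; [apply in_succ; left; apply (app_in Hf), F|]; auto.
           ++ intros y [_ [[H _]|[_ H]]]; congruence.
      * intros y Hy; apply in_succ in Hy as [Hy| ->].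
        -- destruct (S y Hy) as (x & Hx & ->); rewrite in_sep in Hx by def.
           destruct Hx as [Hx N]; exists x; split; [tauto|].
           intros z [Hz [[-> H]|[Nz H]]].
           ++ rewrite H in Hy; destruct (mem_irrefl Hy).
           ++ apply I; auto.
        -- exists n; split; [tauto|].
           intros z [Hz [[-> H]|[Nz H]]]; auto.
           assert (Q := app_in Hf (F z Hz Nz)); rewrite <- H in Q.
           destruct (mem_irrefl Q).
    + exists m; split; auto.
      replace s with (sep s (fun x => x <> n)); auto.
      apply set_ext; intros x; rewrite in_sep by def.
      split; [tauto|]; intros H; split; auto; congruence.
Qed.

Lemma bounded_finite h a n : is_inj h a omega -> n ∈ omega ->
  (forall x, x ∈ a -> app h x ∈ n) -> ~ infinite a.
Proof.
  intros H Hn B K; apply infinite_iff in K; apply K.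
  destruct (@subset_nat_finite n Hn
              (sep omega (fun y => exists x, x ∈ a /\ y = app h x)))
    as (m & Hm & E).
  - intros y Hy; rewrite in_sep in Hy by def.
    destruct Hy as (_ & x & Hx & ->); auto.
  - exists m; split; auto; exact (equipotent_trans (is_inj_range H) E).
Qed.

(** An infinite set [a] with an injection [h] into omega has elements of
    arbitrarily large index, so the sequence in which each term is followed by
    the element of least larger index is defined. *)
Lemma countable_infinite (a : V) : embeds a omega -> infinite a -> embeds omega a.
Proof.
  intros (h & Hh) Inf.
  set (G := fun (n x : V) => pick h a (fun y => app h x ∈ app h y)).
  assert (S : forall x, x ∈ a -> exists y, y ∈ a /\ app h x ∈ app h y).
  { intros x Hx; apply NNPP; intros N.
    assert (Hn := app_in (proj1 Hh) Hx).
    apply (bounded_finite Hh (succ_omega Hn)); auto.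
    intros y Hy; apply in_succ.
    destruct (nat_trichotomy Hn (app_in (proj1 Hh) Hy)) as [K|[K|K]]; auto.
    destruct N; eauto. }
  assert (HG : forall n x, x ∈ a -> G n x ∈ a /\ app h x ∈ app h (G n x))
    by (intros n x Hx;
        apply (pickP (P := fun y => app h x ∈ app h y) Hh); [def|auto]).
  assert (E : exists x, x ∈ a).
  { apply NNPP; intros N; apply (bounded_finite Hh empty_omega); auto.
    intros x Hx; destruct N; eauto. }
  destruct E as (x0 & Hx0).
  destruct (@recursion G a x0) as (f & Hf & _ & F1); [unfold G; def|auto| |].
  { intros n x _ Hx; apply HG, Hx. }
  exists f; split; auto.
  assert (Mono : forall n, n ∈ omega -> forall m, m ∈ n ->
                   app h (app f m) ∈ app h (app f n)).
  { omega_induction.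
    - intros m H; destruct (not_in_empty H).
    - intros n Hn IH m Hm; rewrite F1 by auto.
      assert (K := proj2 (HG n _ (app_in Hf Hn))).
      apply in_succ in Hm as [Hm| ->]; auto.
      refine (nat_mem_trans _ (IH m Hm) K).
      apply (app_in (proj1 Hh)), HG, (app_in Hf Hn). }
  intros m n Hm Hn E.
  destruct (nat_trichotomy Hn Hm) as [K|[K|K]]; auto;
    apply Mono in K; auto; rewrite E in K; destruct (mem_irrefl K).
Qed.

(** From left to right the sequence is the orbit, under a bijection of [a] onto
    a proper subset [s], of a point outside [s].  From right to left the
    bijection shifts a given injective sequence by one and fixes all other
    points. *)
Lemma Dedekind_infinite_iff (a : V) : Dedekind_infinite a <-> embeds omega a.
Proof.
  split.
  - intros (s & Hs & Ns & E).
    destruct (equipotent_elim E) as (f & [Hf I] & _).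
    assert (X : exists x, x ∈ a /\ x ∉ s).
    { apply NNPP; intros N; apply Ns, set_ext; intros x; split; [apply Hs|].
      intros Hx; apply NNPP; intros K; apply N; eauto. }
    destruct X as (x0 & Hx0 & N0).
    destruct (@recursion (fun n x => app f x) a x0) as (g & Hg & G0 & G1);
      [def|auto| |].
    { intros n x _ Hx; apply Hs, (app_in Hf Hx). }
    exists g; split; auto.
    assert (K : forall n, n ∈ omega -> app g (succ n) <> app g empty).
    { intros n Hn K; rewrite G0, G1 in K by auto.
      apply N0; rewrite <- K; apply (app_in Hf), (app_in Hg), Hn. }
    assert (J : forall m, m ∈ omega -> forall n, n ∈ omega ->
                  app g m = app g n -> m = n); [|intros m n Hm Hn; auto].
    omega_induction.
    + intros n Hn E'; destruct (omega_cases Hn) as [->|(m & Hm & ->)]; auto.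
      destruct (K m Hm); auto.
    + intros m Hm IH n Hn E'.
      destruct (omega_cases Hn) as [->|(k & Hk & ->)].
      * destruct (K m Hm); auto.
      * f_equal; apply IH; auto; apply I; try (apply (app_in Hg); auto).
        rewrite <- !G1; auto.
  - intros (g & Hg & I).
    exists (sep a (fun x => x <> app g empty)); split; [|split].
    + intros x Hx; rewrite in_sep in Hx by def; tauto.
    + intros E; assert (K := app_in Hg empty_omega); rewrite <- E in K.
      rewrite in_sep in K by def; tauto.
    + apply (equipotent_intro (R := fun x y =>
        (exists n, n ∈ omega /\ x = app g n /\ y = app g (succ n)) \/
        ((~ exists n, n ∈ omega /\ x = app g n) /\ y = x))); [def| |].
      * intros x Hx; destruct (classic (exists n, n ∈ omega /\ x = app g n))
          as [(n & Hn & ->)|N].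
        -- exists (app g (succ n)); split.
           ++ rewrite in_sep by def; split; [split|left; eauto]; [apply (app_in Hg), succ_omega, Hn|].
              intros E; apply I, succ_neq_empty in E;
                auto using empty_omega, succ_omega.
           ++ intros y [_ [(m & Hm & E & ->)|[N _]]].
              ** apply I in E as ->; auto.
              ** destruct N; eauto.
        -- exists x; split.
           ++ rewrite in_sep by def; repeat split; auto; intros ->; apply N; eauto using empty_omega.
           ++ intros y [_ [(m & Hm & E & _)|[_ ->]]]; auto.
              destruct N; eauto.
      * intros y Hy; rewrite in_sep in Hy by def; destruct Hy as [Hy Ny].
        destruct (classic (exists n, n ∈ omega /\ y = app g n))
          as [(n & Hn & ->)|N].
        -- destruct (omega_cases Hn) as [->|(m & Hm & ->)]; [tauto|].
           exists (app g m); split; [split; [apply (app_in Hg Hm)|left; eauto]|].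
           intros x [Hx [(k & Hk & -> & E)|[N E]]].
           ++ apply I, succ_inj in E as ->; auto using succ_omega.
           ++ subst x; destruct N; eauto.
        -- exists y; split; auto.
           intros x [Hx [(k & Hk & -> & E)|[_ E]]]; auto.
           destruct N; eauto using succ_omega.
Qed.
End Arithmetic.

(** * Closures and convergent sequences *)

Section Topology.
Context {V : set_structure} {ZF : is_ZF_model V}.

(** The closure of [D] in the space [X] with topology [t]. *)
Definition cl (X t D : V) : V :=
  sep X (fun x => forall o, o ∈ t -> x ∈ o -> exists z, z ∈ o /\ z ∈ D).

Lemma in_cl X t D x : x ∈ cl X t D <->
  x ∈ X /\ forall o, o ∈ t -> x ∈ o -> exists z, z ∈ o /\ z ∈ D.
Proof. unfold cl; rewrite in_sep by def; reflexivity. Qed.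

Lemma cl_subset X t D : cl X t D ⊆ X.
Proof. intros x Hx; apply in_cl in Hx; tauto. Qed.

Lemma subset_cl X t D : D ⊆ X -> D ⊆ cl X t D.
Proof. intros H x Hx; apply in_cl; eauto. Qed.

Lemma cl_mono X t D D' : D ⊆ D' -> cl X t D ⊆ cl X t D'.
Proof.
  intros H x; rewrite !in_cl; intros [Hx K]; split; auto.
  intros o Ho Hxo; destruct (K o Ho Hxo) as (z & Hz & Hz'); eauto.
Qed.

Context {X t : V} (topX : is_topology X t).

Lemma open_of_nbhds u : u ⊆ X ->
  (forall x, x ∈ u -> exists o, o ∈ t /\ x ∈ o /\ o ⊆ u) -> u ∈ t.
Proof.
  intros Hu H; apply (top_union topX) with (s := sep t (fun o => o ⊆ u)).
  - intros o Ho; rewrite in_sep in Ho by def; tauto.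
  - intros x; split.
    + intros Hx; destruct (H x Hx) as (o & Ho & Hxo & K).
      exists o; rewrite in_sep by def; auto.
    + intros (o & Hx & Ho); rewrite in_sep in Ho by def.
      destruct Ho as [_ Ho]; auto.
Qed.

Lemma closed_iff c : closed X t c <-> c ⊆ X /\ cl X t c ⊆ c.
Proof.
  split.
  - intros (Hc & u & Hu & Ho); split; auto.
    intros x Hx; apply in_cl in Hx as [Hx K]; apply NNPP; intros N.
    destruct (K u Ho) as (z & Hz & Hz'); [apply Hu; auto|].
    apply Hu in Hz; tauto.
  - intros (Hc & K); split; auto.
    exists (diff X c); split; [intros x; apply in_diff|].
    apply open_of_nbhds.
    + intros x Hx; apply in_diff in Hx; tauto.
    + intros x Hx; apply in_diff in Hx as [Hx N].
      apply NNPP; intros M; apply N, K, in_cl; split; auto.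
      intros o Ho Hxo; apply NNPP; intros L; apply M; exists o.
      repeat split; auto; intros z Hz; apply in_diff; split.
      * apply (top_sub topX Ho Hz).
      * intros Hzc; eauto.
Qed.

Lemma closed_cl D : closed X t (cl X t D).
Proof.
  apply closed_iff; split; [apply cl_subset|].
  intros x Hx; apply in_cl in Hx as [Hx K]; apply in_cl; split; auto.
  intros o Ho Hxo; destruct (K o Ho Hxo) as (z & Hz & Hz').
  apply in_cl in Hz' as [_ Hz']; auto.
Qed.

Lemma closed_sequentially_closed c : closed X t c -> sequentially_closed X t c.
Proof.
  intros H; apply closed_iff in H as [Hc K]; split; auto.
  intros w s x Hw Hs Hx L; apply K, in_cl; split; auto.
  apply is_omega_iff in Hw as ->.
  intros o Ho Hxo; destruct (L o Ho Hxo) as (n & Hn & Hs').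
  exists (app s n); split; [|apply (app_in Hs Hn)].
  apply (Hs' n); auto; [right; auto|].
  apply (related_app _ _ Hs); auto.
Qed.

(** If a condition [Q k] holds near [x] for each [k], then near [x] the first
    [m] conditions hold simultaneously. *)
Lemma nbhd_forall (Q : V -> V -> Prop) x : def2 Q -> x ∈ X ->
  (forall k, k ∈ omega ->
     exists o, o ∈ t /\ x ∈ o /\ forall z, z ∈ o -> Q k z) ->
  forall m, m ∈ omega ->
    exists o, o ∈ t /\ x ∈ o /\ forall z, z ∈ o -> forall k, k ∈ m -> Q k z.
Proof.
  intros D Hx H; omega_induction.
  - exists X; repeat split; auto; [apply (top_full topX)|].
    intros z _ k Hk; destruct (not_in_empty Hk).
  - intros m Hm (o & Ho & Hxo & K); destruct (H m Hm) as (o' & Ho' & Hxo' & K').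
    exists (cap o o'); repeat split.
    + apply (top_inter topX Ho Ho'); intros z; apply in_cap.
    + apply in_cap; auto.
    + intros z Hz k Hk; apply in_cap in Hz as [Hz Hz'].
      apply in_succ in Hk as [Hk| ->]; auto.
Qed.

(** The [m]-th term of the sequence is the element of least index of [D] that
    lies in the first [m] members of a local base. *)
Lemma cl_countable_sequence (fcX : first_countable X t) D x :
  embeds D omega -> x ∈ cl X t D ->
  exists s, is_fun s omega D /\ converges_to t omega s x.
Proof.
  intros (h & Hh) Hx; apply in_cl in Hx as [Hx K].
  destruct (fcX x Hx) as (b & Hb & B1 & B2).
  apply countable_iff in Hb as (g & Hg).
  (* [Q k z]: the member of the local base with index [k], if any, contains [z]. *)
  set (Q := fun k z => forall u, u ∈ b -> app g u = k -> z ∈ u).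
  assert (DQ : def2 Q) by (unfold Q; def).
  assert (HQ : forall m, m ∈ omega -> exists o, o ∈ t /\ x ∈ o /\
                 forall z, z ∈ o -> forall k, k ∈ m -> Q k z).
  { apply nbhd_forall; auto; intros k Hk.
    destruct (classic (exists u, u ∈ b /\ app g u = k)) as [(u & Hu & E)|N].
    - destruct (B1 u Hu) as [Ho Hxu]; exists u; repeat split; auto.
      intros z Hz v Hv E'; replace v with u; auto.
      apply Hg; congruence.
    - exists X; repeat split; auto; [apply (top_full topX)|].
      intros z _ u Hu E; destruct N; eauto. }
  set (G := fun m => pick h D (fun z => forall k, k ∈ m -> Q k z)).
  assert (HG : forall m, m ∈ omega ->
                 G m ∈ D /\ forall k, k ∈ m -> Q k (G m)).
  { intros m Hm.
    apply (pickP (P := fun z => forall k, k ∈ m -> Q k z) Hh); [def|].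
    destruct (HQ m Hm) as (o & Ho & Hxo & L).
    destruct (K o Ho Hxo) as (z & Hz & Hz'); eauto. }
  destruct (@exists_fun _ _ G omega D) as (s & Hs & E).
  { unfold G; def. }
  { intros m Hm; apply HG, Hm. }
  exists s; split; auto.
  intros o Ho Hxo; destruct (B2 o Ho Hxo) as (u & Hu & Huo).
  exists (succ (app g u)).
  assert (Hk := app_in (proj1 Hg) Hu); split; [apply succ_omega, Hk|].
  intros m Hm Hle y Hy; apply (related_app _ _ Hs) in Hy as [_ ->].
  rewrite E by auto; apply Huo, (proj2 (HG m Hm) (app g u)); auto.
  assert (Hu' : app g u ∈ succ (app g u)) by (apply in_succ; auto).
  destruct Hle as [Hle| <-]; auto.
  exact (nat_mem_trans Hm Hu' Hle).
Qed.

(** In a first-countable space a sequentially closed set contains the closure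
    of each of its countable subsets. *)
Lemma cl_countable_subset (fcX : first_countable X t) D c :
  sequentially_closed X t c -> D ⊆ c -> embeds D omega -> cl X t D ⊆ c.
Proof.
  intros [Hc H] HD E x Hx.
  destruct (cl_countable_sequence fcX E Hx) as (s & Hs & L).
  apply (H omega s); auto; [apply is_omega_omega| |apply (cl_subset Hx)].
  split; [|apply Hs].
  intros p Hp; destruct (proj1 Hs p Hp) as (n & y & Hn & Hy & K).
  exists n, y; auto.
Qed.

Lemma embeds_omega_countable_subset (c : V) : embeds omega c ->
  exists D, D ⊆ c /\ embeds D omega /\ embeds omega D.
Proof.
  intros (f & Hf); assert (K := is_inj_range Hf).
  exists (sep c (fun y => exists x, x ∈ omega /\ y = app f x)).
  split; [|split].
  - intros y Hy; rewrite in_sep in Hy by def; tauto.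
  - apply (exists_inj (G := fun y => the (fun x => x ∈ omega /\ y = app f x)));
      [def| |].
    + intros y Hy; rewrite in_sep in Hy by def.
      destruct Hy as (_ & x & Hx & ->).
      rewrite (the_eq (P := fun z => z ∈ omega /\ app f x = app f z) (y := x));
        auto.
      intros z [Hz E]; apply Hf; auto.
    + intros y y' Hy Hy'; rewrite in_sep in Hy, Hy' by def.
      destruct Hy as (_ & x & Hx & ->), Hy' as (_ & x' & Hx' & ->).
      rewrite (the_eq (P := fun z => z ∈ omega /\ app f x = app f z) (y := x));
        [|auto|intros z [Hz E]; apply Hf; auto].
      rewrite (the_eq (P := fun z => z ∈ omega /\ app f x' = app f z) (y := x'));
        [|auto|intros z [Hz E]; apply Hf; auto].
      congruence.
  - apply equipotent_embeds, K.
Qed.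

Lemma UIC_UISC : UIC X t -> UISC X t.
Proof.
  intros H a Ha U; destruct (H a Ha U) as (c & Hc & I & K).
  exists c; auto using closed_sequentially_closed.
Qed.

Lemma UIC_ISCIC (fcX : first_countable X t) : UIC X t -> ISCIC X t.
Proof.
  intros H a I S.
  destruct (classic (countable a)) as [C|U]; [|apply H; auto; apply S].
  exists a; repeat split; auto; [intros x; auto|apply S|].
  apply closed_iff; split; [apply S|].
  apply cl_countable_subset; auto; [intros x; auto|].
  apply countable_iff, C.
Qed.

Lemma ISCIC_UISC_UIC : ISCIC X t -> UISC X t -> UIC X t.
Proof.
  intros H H' a Ha U; destruct (H' a Ha U) as (c & Hc & I & S).
  destruct (H c I S) as (c' & Hc' & I' & S').
  exists c'; repeat split; try apply S'; auto; intros x Hx; auto.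
Qed.

Lemma IDI_UISC_UIC (fcX : first_countable X t) : IDI X -> UISC X t -> UIC X t.
Proof.
  intros H H' a Ha U; destruct (H' a Ha U) as (c & Hc & I & S).
  assert (K : embeds omega c)
    by (apply Dedekind_infinite_iff, H; auto; apply S).
  destruct (embeds_omega_countable_subset K) as (D & HD & E & E').
  exists (cl X t D); split; [|split].
  - intros x Hx; apply Hc; exact (cl_countable_subset fcX S HD E Hx).
  - apply embeds_omega_infinite, (embeds_trans E'), embeds_subset, subset_cl.
    intros x Hx; apply S; auto.
  - apply closed_cl.
Qed.
End Topology.

(** * Real numbers of the model *)

Section Reals.
Context {V : set_structure} {ZF : is_ZF_model V}.

Lemma related2_iff (f a b x y z : V) : is_fun2 f a b ->
  related2 f x y z <-> x ∈ a /\ y ∈ a /\ z = app f (pair x y).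
Proof.
  intros (c & Hc & Hf); apply is_product_iff in Hc as ->; split.
  - intros (p & Hp & H); apply is_pair_iff in Hp as ->.
    apply (related_app _ _ Hf) in H as [H ->].
    apply pair_in_prod in H; tauto.
  - intros (Hx & Hy & ->); exists (pair x y); rewrite is_pair_iff; split; auto.
    apply (related_app _ _ Hf); rewrite pair_in_prod; auto.
Qed.

Lemma fun2_in (f a b x y : V) : is_fun2 f a b -> x ∈ a -> y ∈ a ->
  app f (pair x y) ∈ b.
Proof.
  intros (c & Hc & Hf) Hx Hy; apply is_product_iff in Hc as ->.
  apply (app_in Hf), pair_in_prod; auto.
Qed.

Context {R : real_data V} (HR : is_real_field R).

(** The operations of the real field as functions of the metatheory. *)
Definition add (x y : V) : V := app (radd R) (pair x y).
Definition mul (x y : V) : V := app (rmul R) (pair x y).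
Local Notation K := (rset R).
Local Notation "0" := (rzero R).
Local Notation "1" := (rone R).
Local Notation "x ≤ y" := (rleq R x y) (at level 70).
Local Notation "x ≺ y" := (rlt R x y) (at level 70).

Lemma radd_iff x y z : related2 (radd R) x y z <-> x ∈ K /\ y ∈ K /\ z = add x y.
Proof. apply (related2_iff _ _ _ (rf_add HR)). Qed.

Lemma rmul_iff x y z : related2 (rmul R) x y z <-> x ∈ K /\ y ∈ K /\ z = mul x y.
Proof. apply (related2_iff _ _ _ (rf_mul HR)). Qed.

Lemma add_in x y : x ∈ K -> y ∈ K -> add x y ∈ K.
Proof. apply (fun2_in (rf_add HR)). Qed.

Lemma mul_in x y : x ∈ K -> y ∈ K -> mul x y ∈ K.
Proof. apply (fun2_in (rf_mul HR)). Qed.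

Lemma addC x y : x ∈ K -> y ∈ K -> add x y = add y x.
Proof.
  intros Hx Hy; apply (radd_iff y x), (rf_addC HR), radd_iff; auto.
Qed.

Lemma addA x y z : x ∈ K -> y ∈ K -> z ∈ K ->
  add x (add y z) = add (add x y) z.
Proof.
  intros Hx Hy Hz; apply radd_iff.
  apply (rf_addA HR) with (x := x) (y := y) (yz := add y z);
    apply radd_iff; auto using add_in.
Qed.

Lemma add0 x : x ∈ K -> add x 0 = x.
Proof. intros Hx; symmetry; apply radd_iff, (rf_add0 HR), Hx. Qed.

Lemma zero_add x : x ∈ K -> add 0 x = x.
Proof. intros Hx; assert (H0 := rf_zero HR); rewrite addC, add0; auto. Qed.

Lemma opp_ex x : x ∈ K -> exists y, y ∈ K /\ add x y = 0.
Proof.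
  intros Hx; destruct (rf_opp HR Hx) as (y & Hy & E); exists y.
  apply radd_iff in E; intuition.
Qed.

Lemma mul_distr x y z : x ∈ K -> y ∈ K -> z ∈ K ->
  mul x (add y z) = add (mul x y) (mul x z).
Proof.
  intros Hx Hy Hz; apply radd_iff.
  apply (rf_distr HR) with (x := x) (y := y) (z := z) (yz := add y z);
    rewrite ?radd_iff, ?rmul_iff; auto using add_in.
Qed.

Lemma mul_one x : x ∈ K -> mul x 1 = x.
Proof. intros Hx; symmetry; apply rmul_iff, (rf_mul1 HR), Hx. Qed.

Lemma le_add x y z : x ∈ K -> y ∈ K -> z ∈ K -> x ≤ y -> add x z ≤ add y z.
Proof.
  intros Hx Hy Hz H.
  apply (rf_le_add HR) with (x := x) (y := y) (z := z);
    rewrite ?radd_iff; auto.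
Qed.

Lemma le_add2 x y x' y' : x ∈ K -> y ∈ K -> x' ∈ K -> y' ∈ K ->
  x ≤ y -> x' ≤ y' -> add x x' ≤ add y y'.
Proof.
  intros Hx Hy Hx' Hy' H H'.
  apply (rf_le_trans HR) with (y := add y x'); auto using add_in, le_add.
  rewrite (addC Hy Hx'), (addC Hy Hy'); auto using le_add.
Qed.

Lemma add_cancel x y z : x ∈ K -> y ∈ K -> z ∈ K -> add x z = add y z -> x = y.
Proof.
  intros Hx Hy Hz E; destruct (opp_ex Hz) as (w & Hw & O).
  rewrite <- (add0 Hx), <- (add0 Hy), <- O, !addA, E; auto.
Qed.

Lemma lt_add x y z : x ∈ K -> y ∈ K -> z ∈ K -> x ≺ y -> add x z ≺ add y z.
Proof.
  intros Hx Hy Hz [H N]; split; auto using le_add.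
  intros E; apply N; eauto using add_cancel.
Qed.

Lemma le_lt_trans x y z : x ∈ K -> y ∈ K -> z ∈ K -> x ≤ y -> y ≺ z -> x ≺ z.
Proof.
  intros Hx Hy Hz H [H' N]; split; [exact (rf_le_trans HR Hx Hy Hz H H')|].
  intros ->; apply N; apply (rf_le_antisym HR); auto.
Qed.

Lemma lt_le_trans x y z : x ∈ K -> y ∈ K -> z ∈ K -> x ≺ y -> y ≤ z -> x ≺ z.
Proof.
  intros Hx Hy Hz [H N] H'; split; [exact (rf_le_trans HR Hx Hy Hz H H')|].
  intros ->; apply N; apply (rf_le_antisym HR); auto.
Qed.

Lemma lt_not_le x y : x ∈ K -> y ∈ K -> x ≺ y -> ~ y ≤ x.
Proof. intros Hx Hy [H N] H'; apply N, (rf_le_antisym HR); auto. Qed.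

Lemma not_le_lt x y : x ∈ K -> y ∈ K -> ~ x ≤ y -> y ≺ x.
Proof.
  intros Hx Hy H; destruct (rf_le_total HR Hx Hy) as [H'|H']; [tauto|].
  split; auto; intros ->; apply H, (rf_le_refl HR Hx).
Qed.

Lemma sub_pos x y : x ∈ K -> y ∈ K -> x ≺ y ->
  exists e, e ∈ K /\ 0 ≺ e /\ add x e = y.
Proof.
  intros Hx Hy H; destruct (opp_ex Hx) as (w & Hw & O).
  exists (add y w); split; [auto using add_in|split].
  - rewrite <- O; auto using lt_add.
  - rewrite (addC Hy Hw), addA, O, zero_add; auto.
Qed.

Lemma mul_zero x : x ∈ K -> mul x 0 = 0.
Proof.
  intros Hx; assert (H0 := rf_zero HR).
  apply (@add_cancel _ _ (mul x 0)); auto using mul_in.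
  rewrite <- mul_distr, !zero_add; auto using mul_in.
Qed.

Lemma zero_le_one : 0 ≤ 1.
Proof.
  assert (H0 := rf_zero HR); assert (H1 := rf_one HR).
  destruct (rf_le_total HR H0 H1) as [H|H]; auto.
  destruct (opp_ex H1) as (m & Hm & O).
  assert (P : 0 ≤ m)
    by (rewrite <- O at 1; rewrite <- (zero_add Hm) at 2; auto using le_add).
  replace 1 with (mul m m).
  - apply (rf_le_mul HR Hm Hm P P), rmul_iff; auto.
  - apply (@add_cancel _ _ m); auto using mul_in.
    rewrite <- (mul_one Hm) at 3; rewrite <- mul_distr, (addC Hm H1), O by auto.
    auto using mul_zero.
Qed.

(** The inverse [h] of [1 + 1]. *)
Lemma half_ex : exists h, h ∈ K /\ 0 ≤ h /\ add h h = 1.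
Proof.
  assert (H0 := rf_zero HR); assert (H1 := rf_one HR).
  assert (H2 := add_in H1 H1).
  assert (L : 0 ≺ 1)
    by (split; [apply zero_le_one|intros E; apply (rf_one_neq_zero HR); auto]).
  assert (N : add 1 1 <> 0).
  { intros E; apply (lt_not_le H0 H1 L); rewrite <- E.
    rewrite <- (zero_add H1) at 1; apply le_add; auto; apply L. }
  destruct (rf_inv HR H2 N) as (h & Hh & E).
  apply (rf_mulC HR), rmul_iff in E as (_ & _ & E).
  rewrite mul_distr, mul_one in E by auto.
  exists h; repeat split; auto.
  apply NNPP; intros M; apply not_le_lt in M; auto.
  apply (lt_not_le H0 H1 L); rewrite E.
  rewrite <- (add0 H0); apply le_add2; auto; apply M.
Qed.

(** A sequence of positive reals in which each term is twice the next one. *)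
Lemma halving_sequence : exists s, is_fun s omega K /\
  (forall n, n ∈ omega -> 0 ≺ app s n) /\
  (forall n, n ∈ omega -> add (app s (succ n)) (app s (succ n)) = app s n).
Proof.
  assert (H0 := rf_zero HR); assert (H1 := rf_one HR).
  destruct half_ex as (h & Hh & Ph & E).
  assert (D : forall x, x ∈ K -> add (mul x h) (mul x h) = x)
    by (intros x Hx; rewrite <- mul_distr, E, mul_one; auto).
  destruct (@recursion _ _ (fun _ x => mul x h) (sep K (fun x => 0 ≺ x)) 1)
    as (s & Hs & _ & S1).
  - def.
  - rewrite in_sep by def; repeat split; auto; [apply zero_le_one|].
    intros N; apply (rf_one_neq_zero HR); auto.
  - intros n x _; rewrite !in_sep by def; intros [Hx [Px Nx]].
    repeat split; auto using mul_in.
    + apply (rf_le_mul HR Hx Hh Px Ph), rmul_iff; auto.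
    + intros N; apply Nx; rewrite <- (D x Hx), <- N, add0; auto.
  - assert (Q : forall n, n ∈ omega -> app s n ∈ K /\ 0 ≺ app s n).
    { intros n Hn; assert (A := app_in Hs Hn); rewrite in_sep in A by def.
      exact A. }
    exists s; split; [|split].
    + split; [|apply Hs].
      intros p Hp; destruct (proj1 Hs p Hp) as (n & y & Hn & Hy & A).
      rewrite in_sep in Hy by def; exists n, y; tauto.
    + apply Q.
    + intros n Hn; rewrite S1 by auto; apply D, Q, Hn.
Qed.

(** If [e] bounded the sequence from below, the supremum [l] of the lower bounds
    would be positive; but [l + l] is a lower bound as well. *)
Lemma halving_to_zero s : is_fun s omega K ->
  (forall n, n ∈ omega -> add (app s (succ n)) (app s (succ n)) = app s n) ->
  forall e, e ∈ K -> 0 ≺ e -> exists n, n ∈ omega /\ app s n ≺ e.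
Proof.
  intros Hs S e He Pe; apply NNPP; intros N.
  assert (H0 := rf_zero HR).
  set (L := sep K (fun x => forall n, n ∈ omega -> x ≤ app s n)).
  assert (HL : forall x, x ∈ L <-> x ∈ K /\ forall n, n ∈ omega -> x ≤ app s n)
    by (intros x; unfold L; rewrite in_sep by def; reflexivity).
  assert (eL : e ∈ L).
  { apply HL; split; auto; intros n Hn.
    apply NNPP; intros M; apply N; exists n; split; auto.
    apply not_le_lt; auto; apply (app_in Hs Hn). }
  destruct (rf_complete HR (a := L)) as (l & [Hl U] & M).
  - intros x Hx; apply HL in Hx; tauto.
  - exists e; auto.
  - exists (app s empty); split; [apply (app_in Hs), empty_omega|].
    intros x Hx; apply HL in Hx as [_ Hx]; apply Hx, empty_omega.
  - assert (B : forall n, n ∈ omega -> l ≤ app s n).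
    { intros n Hn; apply M; split; [apply (app_in Hs Hn)|].
      intros x Hx; apply HL in Hx as [_ Hx]; auto. }
    assert (C : add l l ∈ L).
    { apply HL; split; [auto using add_in|].
      intros n Hn; rewrite <- S by auto.
      assert (A := app_in Hs (succ_omega Hn)).
      apply le_add2; auto using succ_omega. }
    assert (P : 0 ≺ l) by (apply (@lt_le_trans _ e); auto).
    apply (lt_not_le Hl (add_in Hl Hl)); auto.
    rewrite <- (zero_add Hl) at 1; auto using lt_add.
Qed.
End Reals.

(** * Entourages of a Cantor complete metric *)

(** The consequences of Cantor complete metrizability that matter below, for
    the relations [E n x y] saying that the distance of [x] and [y] is at most
    [s n], where [s] is a halving sequence. *)
Record complete_entourages {V : set_structure} {ZF : is_ZF_model V} (X t : V)
    (E : V -> V -> V -> Prop) : Prop := CompleteEntourages {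
  ent_def : def3 E;
  ent_sym : forall n x y, E n x y -> E n y x;
  ent_comp : forall n x y z, n ∈ omega ->
    E (succ n) x y -> E (succ n) y z -> E n x z;
  ent_sep : forall x y, x ∈ X -> y ∈ X ->
    (forall n, n ∈ omega -> E n x y) -> x = y;
  ent_open : forall o x, o ∈ t -> x ∈ o ->
    exists n, n ∈ omega /\ forall y, E n x y -> y ∈ o;
  ent_nbhd : forall n x, n ∈ omega -> x ∈ X ->
    exists o, o ∈ t /\ x ∈ o /\ forall y, y ∈ o -> E n x y;
  ent_complete : forall F, is_fun F omega (power X) ->
    (forall n, n ∈ omega -> nonempty (app F n) /\ closed X t (app F n)) ->
    (forall m n, m ∈ omega -> n ∈ omega -> nat_le m n -> app F n ⊆ app F m) ->
    (forall k, k ∈ omega -> exists n, n ∈ omega /\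
       forall m, m ∈ omega -> nat_le n m ->
         forall x y, x ∈ app F m -> y ∈ app F m -> E k x y) ->
    exists x, forall n, n ∈ omega -> x ∈ app F n
}.

Section Metric.
Context {V : set_structure} {ZF : is_ZF_model V}.

(** The diameter of a set whose points are pairwise at distance at most [s k]
    exists by order completeness and is at most [s k]. *)
Lemma Cantor_complete_entourages (X t : V) : Cantor_completely_metrizable X t ->
  exists E, complete_entourages X t E.
Proof.
  intros (R & HR & d & Hd & Hc & Ht).
  destruct (halving_sequence HR) as (s & Hs & Ps & Ds).
  assert (Zs := halving_to_zero HR Hs Ds).
  assert (H0 := rf_zero HR).
  assert (Dp := deft2_pair (V := V)).
  assert (Rd := fun x y z => related2_iff x y z (met_fun Hd)).
  set (dist := fun x y => app d (pair x y)).
  assert (Kd : forall x y, x ∈ X -> y ∈ X -> dist x y ∈ rset R)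
    by (intros x y; apply (fun2_in (met_fun Hd))).
  assert (Ka := fun x y => add_in (R := R) HR (x := x) (y := y)).
  assert (Ks := fun n Hn => app_in (x := n) Hs Hn).
  assert (P : forall x y, x ∈ X -> y ∈ X -> rleq R (rzero R) (dist x y))
    by (intros x y Hx Hy; apply (met_ge0 Hd (x := x) (y := y)), Rd; auto).
  assert (Sy : forall x y, x ∈ X -> y ∈ X -> dist x y = dist y x).
  { intros x y Hx Hy; apply (Rd y x), (met_sym Hd), Rd; auto. }
  assert (T : forall x y z, x ∈ X -> y ∈ X -> z ∈ X ->
                rleq R (dist x z) (add (R := R) (dist x y) (dist y z))).
  { intros x y z Hx Hy Hz.
    apply (met_triangle Hd (x := x) (y := y) (z := z)
             (rxy := dist x y) (ryz := dist y z)); try apply Rd; auto.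
    apply (radd_iff HR); auto. }
  exists (fun n x y => x ∈ X /\ y ∈ X /\ rleq R (dist x y) (app s n)).
  constructor.
  - unfold dist; def.
  - intros n x y (Hx & Hy & H); rewrite Sy; auto.
  - intros n x y z Hn (Hx & Hy & H) (_ & Hz & H'); repeat split; auto.
    rewrite <- Ds by auto; assert (A := Ks _ (succ_omega Hn)).
    apply (rf_le_trans HR) with (y := add (R := R) (dist x y) (dist y z));
      auto; apply (le_add2 HR); auto.
  - intros x y Hx Hy H; apply (met_eq0 Hd Hx Hy), Rd; repeat split; auto.
    apply NNPP; intros N.
    destruct (Zs (dist x y)) as (n & Hn & L); auto; [split; auto|].
    apply (lt_not_le HR (Ks _ Hn) (Kd x y Hx Hy) L), H, Hn.
  - intros o x Ho Hx; apply Ht in Ho as [Ho Ho'].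
    destruct (Ho' x Hx) as (e & He & Pe & B).
    destruct (Zs e He Pe) as (n & Hn & L); exists n; split; auto.
    intros y (_ & Hy & H); apply (B y (dist x y)); auto; [apply Rd; auto|].
    apply (le_lt_trans HR) with (y := app s n); auto.
  - intros n x Hn Hx.
    set (B := sep X (fun y => rlt R (dist x y) (app s n))).
    assert (HB : forall y, y ∈ B <-> y ∈ X /\ rlt R (dist x y) (app s n))
      by (intros y; unfold B, dist; rewrite in_sep by def; reflexivity).
    exists B; split; [|split].
    + apply Ht; split; [intros y Hy; apply HB in Hy; tauto|].
      intros y Hy; apply HB in Hy as [Hy L].
      destruct (sub_pos HR (Kd _ _ Hx Hy) (Ks _ Hn) L) as (e & He & Pe & Ee).
      exists e; repeat split; try apply Pe; auto.
      intros z r Hz Hr L'; apply Rd in Hr as (_ & _ & ->).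
      fold (dist y z) in L'; apply HB; split; auto; rewrite <- Ee.
      apply (le_lt_trans HR) with (y := add (R := R) (dist x y) (dist y z));
        auto.
      rewrite (addC HR (Kd _ _ Hx Hy) He).
      rewrite (addC HR (Kd _ _ Hx Hy) (Kd _ _ Hy Hz)).
      apply (lt_add HR); auto.
    + apply HB; split; auto.
      replace (dist x x) with (rzero R); auto.
      apply (Rd x x), (met_eq0 Hd Hx Hx); auto.
    + intros y Hy; apply HB in Hy as [Hy [L _]]; auto.
  - intros F HF HN HM HD.
    destruct (Hc t omega (power X) F) as (x & Hx); auto.
    + apply is_omega_omega.
    + intros y; apply in_power.
    + intros n A HA; apply (related_app _ _ HF) in HA as [Hn ->]; auto.
    + intros m n A B L HA HB.
      apply (related_app _ _ HF) in HA as [Hm ->], HB as [Hn ->]; auto.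
    + intros e He Pe; destruct (Zs e He Pe) as (k & Hk & Lk).
      destruct (HD k Hk) as (n & Hn & L); exists n; split; auto.
      intros m Hm Hle A HA; apply (related_app _ _ HF) in HA as [_ ->].
      set (A := app F m) in *.
      set (D := sep (rset R) (fun r => exists x y,
                  x ∈ A /\ y ∈ A /\ related2 d x y r)).
      assert (AX : A ⊆ X) by (apply in_power, (app_in HF Hm)).
      assert (H : distance_set d A D).
      { intros r; unfold D; rewrite in_sep by def; split; [tauto|].
        intros Hr; split; auto; destruct Hr as (x & y & Hx & Hy & Hr).
        apply Rd in Hr as (_ & _ & ->); apply Kd; auto. }
      assert (UB : upper_bound R D (app s k)).
      { split; auto.
        intros r Hr; apply H in Hr as (x & y & Hx & Hy & Hr).
        apply Rd in Hr as (_ & _ & ->); apply (L m); auto. }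
      destruct (rf_complete HR (a := D)) as (l & Hl).
      * intros r Hr; unfold D in Hr; rewrite in_sep in Hr by def; tauto.
      * destruct (HN m Hm) as [[x Hx] _]; exists (dist x x); apply H.
        exists x, x; repeat split; auto; apply Rd; auto.
      * exists (app s k); exact UB.
      * exists l; split; [exists D; auto|].
        apply (le_lt_trans HR) with (y := app s k); auto; apply Hl; auto.
    + exists x; intros n Hn; apply (Hx n); auto.
      apply (related_app _ _ HF); auto.
Qed.
End Metric.

(** * Infinite closed sets in Cantor complete second-countable spaces *)

Section CantorComplete.
Context {V : set_structure} {ZF : is_ZF_model V}.
Context {X t : V} (topX : is_topology X t) (hausX : Hausdorff X t).
Context {E : V -> V -> V -> Prop} (HE : complete_entourages X t E).
Context {b : V} (Hb : base t b).

(** The closure of [W] has diameter at most [s k], in terms of the entourages. *)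
Definition small (k W : V) : Prop :=
  forall x y, x ∈ cl X t W -> y ∈ cl X t W -> E k x y.

(** Two halvings are lost: one from [W] to points of its closure, one from the
    distance to [y] to that between two points. *)
Lemma exists_small o y k : o ∈ t -> y ∈ o -> k ∈ omega ->
  exists W, W ∈ b /\ y ∈ W /\ W ⊆ o /\ small k W.
Proof.
  intros Ho Hy Hk; assert (HyX := top_sub topX Ho Hy).
  assert (Hk1 := succ_omega Hk); assert (Hk2 := succ_omega Hk1).
  destruct (ent_nbhd HE Hk2 HyX) as (u & Hu & Hyu & Eu).
  destruct (proj2 Hb (cap o u) y) as (W & HW & HyW & HWo).
  - apply (top_inter topX Ho Hu); intros z; apply in_cap.
  - apply in_cap; auto.
  - exists W; repeat split; auto.
    + intros z Hz; apply HWo, in_cap in Hz; tauto.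
    + assert (C : forall z, z ∈ cl X t W -> E (succ k) y z).
      { intros z Hz; apply in_cl in Hz as [HzX Hz].
        destruct (ent_nbhd HE Hk2 HzX) as (v & Hv & Hzv & Ev).
        destruct (Hz v Hv Hzv) as (w & Hwv & HwW).
        apply HWo, in_cap in HwW as [_ Hwu].
        apply (ent_comp HE Hk1 (Eu w Hwu)), (ent_sym HE), Ev, Hwv. }
      intros x x' Hx Hx'.
      apply (ent_comp HE Hk (y := y)); auto; apply (ent_sym HE); auto.
Qed.


Context {c : V} (Hc : closed X t c).

(** The basic open sets that meet [c]. *)
Definition meeting : V := sep b (fun U => exists z, z ∈ U /\ z ∈ c).

Lemma in_meeting U : U ∈ meeting <-> U ∈ b /\ exists z, z ∈ U /\ z ∈ c.
Proof. unfold meeting; rewrite in_sep by def; reflexivity. Qed.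

Lemma meeting_subset U : U ∈ meeting -> U ⊆ X.
Proof. intros H; apply in_meeting in H as [H _]; apply (top_sub topX), Hb, H. Qed.

Context {g : V} (Hg : is_inj g meeting omega).

(** The next set of a greedy sequence: the first set, in the enumeration [g], of
    the basic open sets meeting [c] that lies in [U] and has a [k]-small
    closure. *)
Definition shrink (k U : V) : V := pick g meeting (fun W => W ⊆ U /\ small k W).

Lemma deft2_shrink : deft2 shrink.
Proof. assert (DE := ent_def HE); def. Qed.

Lemma shrinkP k U : k ∈ omega -> U ∈ meeting ->
  shrink k U ∈ meeting /\ shrink k U ⊆ U /\ small k (shrink k U).
Proof.
  intros Hk HU; assert (DE := ent_def HE).
  apply (pickP (P := fun W => W ⊆ U /\ small k W) Hg); [def|].
  apply in_meeting in HU as [HU (z & Hz & Hzc)].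
  destruct (exists_small (proj1 Hb _ HU) Hz Hk) as (W & HW & HzW & HWU & S).
  exists W; rewrite in_meeting; repeat split; eauto.
Qed.

(** [greedy U f]: the sequence [f] of basic open sets meeting [c] starts with
    [U], and each next set is chosen inside the previous one with a small
    closure. *)
Definition greedy (U f : V) : Prop := is_rec shrink meeting U f.

Lemma greedy_exists U : U ∈ meeting -> exists f, greedy U f.
Proof.
  intros HU; apply recursion; [apply deft2_shrink|exact HU|].
  intros n W Hn HW; apply (shrinkP Hn HW).
Qed.

Lemma greedy_in U f n : greedy U f -> n ∈ omega -> app f n ∈ meeting.
Proof. intros [H _]; apply (app_in H). Qed.

Lemma greedy_small U f n : greedy U f -> n ∈ omega -> small n (app f (succ n)).
Proof.
  intros H Hn; rewrite (proj2 (proj2 H)) by auto.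
  apply (shrinkP Hn (greedy_in H Hn)).
Qed.

Lemma greedy_decreasing U f : greedy U f -> forall n, n ∈ omega ->
  forall m, nat_le m n -> app f n ⊆ app f m.
Proof.
  intros H; omega_induction.
  - intros m [Hm| ->]; [destruct (not_in_empty Hm)|intros x; auto].
  - intros n Hn IH m [Hm| ->]; [|intros x; auto].
    intros x Hx; rewrite (proj2 (proj2 H)) in Hx by auto.
    apply (shrinkP Hn (greedy_in H Hn)) in Hx.
    apply in_succ in Hm; apply (IH m Hm), Hx.
Qed.

(** [limit U x]: [x] is the point of [c] to which the greedy sequence starting
    with [U] shrinks. *)
Definition limit (U x : V) : Prop :=
  x ∈ c /\ exists f, greedy U f /\ forall n, n ∈ omega -> x ∈ cl X t (app f n).

Lemma def2_limit : def2 limit.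
Proof. assert (DG := deft2_shrink); def. Qed.

Lemma limit_exists U : U ∈ meeting -> exists x, limit U x.
Proof.
  intros HU; destruct (greedy_exists HU) as (f & Hf).
  assert (DE := ent_def HE).
  destruct (@exists_fun _ _ (fun n => cl X t (cap (app f n) c)) omega (power X))
    as (F & HF & EF); [def| |].
  { intros n Hn; apply in_power, cl_subset. }
  assert (S : forall n, cap (app f n) c ⊆ app f n)
    by (intros n x Hx; apply in_cap in Hx; tauto).
  destruct (ent_complete HE HF) as (x & Hx).
  - intros n Hn; rewrite EF by auto; split; [|apply (closed_cl topX)].
    assert (K := greedy_in Hf Hn).
    assert (KX := meeting_subset K).
    apply in_meeting in K as [_ (z & Hz & Hzc)].
    exists z; apply subset_cl; [|apply in_cap; auto].
    intros y Hy; apply KX, S, Hy.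
  - intros m n Hm Hn L; rewrite !EF by auto; apply cl_mono.
    intros x Hx; apply in_cap in Hx as [Hx Hxc]; apply in_cap; split; auto.
    apply (greedy_decreasing Hf Hn L), Hx.
  - intros k Hk; exists (succ k); split; [apply succ_omega, Hk|].
    intros m Hm L x y Hx Hy; rewrite EF in Hx, Hy by auto.
    assert (C : cap (app f m) c ⊆ app f (succ k))
      by (intros z Hz; apply (greedy_decreasing Hf Hm L), S, Hz).
    apply (greedy_small Hf Hk); [apply (cl_mono C Hx)|apply (cl_mono C Hy)].
  - exists x; split.
    + apply (closed_iff topX) in Hc as [_ C]; apply C.
      assert (K := Hx _ empty_omega); rewrite EF in K by apply empty_omega.
      revert K; apply cl_mono; intros z Hz; apply in_cap in Hz; tauto.
    + exists f; split; auto; intros n Hn.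
      assert (K := Hx n Hn); rewrite EF in K by auto.
      exact (cl_mono (S n) K).
Qed.

Lemma limit_unique U x y : limit U x -> limit U y -> x = y.
Proof.
  intros [Hx (f & Hf & Lx)] [Hy (f' & Hf' & Ly)].
  assert (cX := proj1 Hc).
  apply (ent_sep HE); auto; intros n Hn.
  assert (Hn1 := succ_omega Hn).
  apply (greedy_small Hf Hn); auto.
  rewrite (recursion_unique Hf Hf' Hn1); auto.
Qed.

Lemma limit_cl U x : limit U x -> x ∈ cl X t U.
Proof.
  intros [_ (f & (_ & <- & _) & L)]; apply L, empty_omega.
Qed.

(** The set of all limits. *)
Definition limits : V := sep c (fun x => exists U, U ∈ meeting /\ limit U x).

Lemma in_limits x : x ∈ limits <-> exists U, U ∈ meeting /\ limit U x.
Proof.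
  assert (DL := def2_limit).
  unfold limits; rewrite in_sep by def; split; [tauto|].
  intros (U & HU & H); split; eauto; apply H.
Qed.

(** A limit is determined by the first basic open set, in the enumeration [g],
    of which it is the limit. *)
Lemma limits_countable : embeds limits omega.
Proof.
  assert (DL := def2_limit).
  set (G := fun x => pick g meeting (fun U => limit U x)).
  assert (HG : forall x, x ∈ limits -> G x ∈ meeting /\ limit (G x) x).
  { intros x Hx; apply in_limits in Hx.
    apply (pickP (P := fun U => limit U x) Hg); [def|exact Hx]. }
  apply (exists_inj (G := fun x => app g (G x))); [unfold G; def| |].
  - intros x Hx; apply (app_in (proj1 Hg)), HG, Hx.
  - intros x y Hx Hy K; apply Hg in K; try apply HG; auto.
    apply (@limit_unique (G x)); [apply HG, Hx|rewrite K; apply HG, Hy].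
Qed.

(** If there were finitely many limits, a point [y] of [c] that is not one of
    them would have a basic neighbourhood whose closure contains no limit. *)
Lemma limits_infinite : infinite c -> infinite limits.
Proof.
  intros Ic; apply infinite_iff; intros (n & Hn & K).
  assert (cX := proj1 Hc).
  assert (Y : exists y, y ∈ c /\ y ∉ limits).
  { apply NNPP; intros N; apply infinite_iff in Ic; apply Ic; exists n.
    split; auto; replace c with limits; auto.
    apply set_ext; intros x; split.
    - intros Hx; apply in_limits in Hx as (U & _ & Hx); apply Hx.
    - intros Hx; apply NNPP; intros M; eauto. }
  destruct Y as (y & Hy & Ny).
  destruct (equipotent_elim K) as (f & [Hf If] & _).
  (* A neighbourhood of [y] that contains no limit, from an enumeration [f] of
     the limits by [n]. *)
  destruct (@nbhd_forall _ _ _ _ topX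
              (fun k z => ~ (z ∈ limits /\ app f z = k)) y) with (m := n)
    as (o & Ho & Hyo & Q); auto; [def| |].
  { intros k Hk.
    destruct (classic (exists z, z ∈ limits /\ app f z = k)) as [(z & Hz & Ez)|N].
    - assert (Hzc : z ∈ c)
        by (apply in_limits in Hz as (U & _ & Hz); apply Hz).
      destruct (hausX (x := y) (y := z)) as (u & v & Hu & Hv & Hyu & Hzv & D);
        auto; [intros ->; auto|].
      exists u; repeat split; auto; intros w Hw [Hwl Ew].
      apply (D w); split; auto; replace w with z; auto.
      apply If; congruence.
    - exists X; repeat split; auto; [apply (top_full topX)|].
      intros w _ Hw; eauto. }
  destruct (ent_open HE Ho Hyo) as (k & Hk & Eo).
  destruct (exists_small Ho Hyo Hk) as (W & HW & HyW & HWo & S).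
  assert (WX := top_sub topX (proj1 Hb _ HW)).
  assert (M : W ∈ meeting) by (apply in_meeting; eauto).
  destruct (limit_exists M) as (x & Hx).
  assert (Hxl : x ∈ limits) by (apply in_limits; eauto).
  assert (Hxo : x ∈ o)
    by (apply Eo, S; [apply subset_cl; auto|apply limit_cl, Hx]).
  apply (Q x Hxo (app f x)); auto; apply (app_in Hf Hxl).
Qed.
End CantorComplete.

Section Theorems.
Context {V : set_structure} {ZF : is_ZF_model V}.
Context {X t : V} (topX : is_topology X t).

Lemma closed_infinite_embeds_omega (hausX : Hausdorff X t) c :
  Cantor_completely_metrizable X t -> second_countable t ->
  closed X t c -> infinite c -> embeds omega c.
Proof.
  intros CC (b & Cb & Hb) Hc Ic.
  destruct (Cantor_complete_entourages CC) as (E & HE).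
  apply countable_iff in Cb.
  assert (M : embeds (meeting (b := b) (c := c)) omega).
  { refine (embeds_trans (embeds_subset _) Cb).
    intros U HU; apply in_meeting in HU; tauto. }
  destruct M as (g & Hg).
  apply (embeds_trans (b :=
    limits (X := X) (t := t) (E := E) (b := b) (c := c) (g := g))).
  - apply countable_infinite.
    + apply (limits_countable topX HE Hb Hc Hg).
    + apply (limits_infinite topX hausX HE Hb Hc Hg Ic).
  - apply embeds_subset; intros x Hx.
    apply (in_limits HE) in Hx as (U & _ & Hx); apply Hx.
Qed.

Lemma UIC_IDI (hausX : Hausdorff X t) :
  Cantor_completely_metrizable X t -> second_countable t -> UIC X t -> IDI X.
Proof.
  intros CC SC H a Ha Ia; apply Dedekind_infinite_iff.
  destruct (classic (countable a)) as [C|U].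
  - apply countable_infinite; auto; apply countable_iff, C.
  - destruct (H a Ha U) as (c & Hca & Ic & Hc).
    apply (embeds_trans (closed_infinite_embeds_omega hausX CC SC Hc Ic)).
    apply embeds_subset, Hca.
Qed.
End Theorems.

Theorem theorem4p4 (V : set_structure) (ZF : is_ZF_model V) (X t : V)
    (topX : is_topology X t) (hausX : Hausdorff X t)
    (fcX : first_countable X t) :
  (UIC X t <-> (ISCIC X t /\ UISC X t)) /\
  ((IDI X /\ UISC X t) -> UIC X t) /\
  (Cantor_completely_metrizable X t -> second_countable t ->
     ((IDI X /\ UISC X t) <-> UIC X t)).
Proof.
  assert (P2 : IDI X /\ UISC X t -> UIC X t)
    by (intros [H H']; exact (IDI_UISC_UIC topX fcX H H')).
  repeat split; auto.
  - apply (UIC_ISCIC topX fcX); auto.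
  - apply (UIC_UISC topX); auto.
  - intros [H H']; exact (ISCIC_UISC_UIC H H').
  - apply (UIC_IDI topX hausX); auto.
  - apply (UIC_UISC topX); auto.
Qed.
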